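(* Let $m\le n$, let $\nu>0$, let $\Omega\subseteq\mathbb{R}^{m\times n}$ be closed and convex, and let $f:\mathbb{R}^{m\times n}\to\mathbb{R}$ be locally Lipschitz with $\widehat{\partial}f(X)=\partial f(X)$ for every $X\in\Omega$. Consider the problem $\min_{X\in\mathbb{R}^{m\times n}}\ \nu f(X)+\mathrm{rank}(X)+\delta_\Omega(X)$. (1) If $\overline{X}\in\mathbb{R}^{m\times n}$ is an M-stationary point of this problem associated to some $\phi\in\mathscr{L}_1$, then $\overline{X}$ is also an R-stationary point of this problem. (2) Conversely, if $\overline{X}$ is an R-stationary point of this problem, then $\overline{X}$ is an M-stationary point of this problem associated to every $\phi\in\mathscr{L}$ with $0\in\partial\widehat{\phi}(0)$.
   Context: $\mathbb{R}^{m\times n}$ carries the trace inner product and Frobenius norm; $\|X\|_*$ and $\|X\|$ are the nuclear and spectral norms; $\sigma(X)\in\mathbb{R}^m$ is the vector of singular values of $X$ in nonincreasing order. $\delta_S$ is the indicator function of a set $S$ ($0$ on $S$, $+\infty$ off $S$). Subdifferentials and normal cones: for an extended-real-valued lsc function $g$ finite at $\bar z$, the regular subdifferential is $\widehat\partial g(\bar z)=\{z^*: \liminf_{z\to\bar z, z\neq\bar z}\frac{g(z)-g(\bar z)-\langle z^*,z-\bar z\rangle}{\|z-\bar z\|}\ge 0\}$, and the limiting subdifferential $\partial g(\bar z)$ is the set of all limits of $z^{k,*}\in\widehat\partial g(z^k)$ with $z^k\to\bar z$, $g(z^k)\to g(\bar z)$. For a set $S$ and $\bar z\in S$, the regular normal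 cone is $\widehat{\mathcal N}_S(\bar z)=\{v:\limsup_{z\to\bar z, z\in S}\frac{\langle v,z-\bar z\rangle}{\|z-\bar z\|}\le 0\}$, and the limiting normal cone $\mathcal{N}_S(\bar z)$ consists of all limits of $v^k\in\widehat{\mathcal N}_S(z^k)$ with $z^k\to\bar z$, $z^k\in S$ (for $S$ convex this is the usual normal cone; it is taken to be empty at points outside $S$). $\partial\,\mathrm{rank}(X)$ is the limiting subdifferential of the rank function on $\mathbb{R}^{m\times n}$. Coderivative: for a multifunction $\mathcal{F}$ and $(\bar z,\bar w)\in\mathrm{gph}\,\mathcal{F}$, $u\in D^*\mathcal{F}(\bar z|\bar w)(v)$ iff $(u,-v)\in\mathcal{N}_{\mathrm{gph}\,\mathcal{F}}(\bar z,\bar w)$. It is applied to the multifunction $X\mapsto\partial\|\cdot\|_*(X)$ (subdifferential of the nuclear norm). $\mathscr{L}$ is the family of proper lsc convex functions $\phi:\mathbb{R}\to(-\infty,+\infty]$ with $\mathrm{int}(\mathrm{dom}\,\phi)\supseteq[0,1]$, $\phi(1)=1>t^*:=\arg\min_{0\le t\le1}\phi(t)$ (a single point) and $\phi(t^* )=0$. $\mathscr{L}_1$ is the family of those $\phi\in\mathscr{L}$ that are differentiable on $(0,1]$. For $\phi\in\mathscr{L}$, $\widehat\phi(t):=\phi(|t|)$ for $t\in\mathbb{R}$ and $\widehat\Phi(x):=\sum_{i=1}^m\widehat\phi(x_i)$ for $x\in\mathbb{R}^m$. R-stationary point: $\overline{X}$ is an R-stationary point of the problem if $0\in\nu\partial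 f(\overline X)+\partial\,\mathrm{rank}(\overline X)+\mathcal{N}_\Omega(\overline X)$. M-stationary point: $\overline X$ is an M-stationary point of the problem associated to $\phi\in\mathscr{L}$ if there exist $\overline W\in\partial\|\cdot\|_*(\overline X)$ and $\Delta W\in\partial(\widehat\Phi\circ\sigma)(\overline W)$ such that $0\in\nu\partial f(\overline X)+\mathcal{N}_\Omega(\overline X)+D^*\partial\|\cdot\|_*(\overline X|\overline W)(\Delta W)$. *)

(* Defs.v *)
From mathcomp Require Import all_boot all_order all_algebra.
From mathcomp Require Import all_classical all_reals all_analysis.
From mathcomp Require spectral complex.

Set Implicit Arguments.
Unset Strict Implicit.
Unset Printing Implicit Defensive.

Import Order.TTheory GRing.Theory Num.Theory.
Import numFieldNormedType.Exports.

Local Open Scope classical_set_scope.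
Local Open Scope ring_scope.

(* The inner product is an explicit argument, so that one set of definitions
   covers R, matrices with the trace inner product, and the product space that
   contains graphs. All norms in difference quotients are the Euclidean norms
   [ipnorm ip]; limits are taken in the library's topology, whose (sup) norm is
   equivalent to the Euclidean one on these finite-dimensional spaces. *)
Section variational_analysis.
Context {R : realType}.

Definition ipnorm {V : normedModType R} (ip : V -> V -> R) (z : V) : R :=
  Num.sqrt (ip z z).

Definition locally_lipschitz {V : normedModType R} (ip : V -> V -> R)
    (f : V -> R) : Prop :=
  forall x : V, exists2 U, nbhs x U &
    exists L : R, forall y z, U y -> U z ->
      `|f y - f z| <= L * ipnorm ip (y - z).

Definition regular_subdiff {V : normedModType R} (ip : V -> V -> R)
    (g : V -> \bar R) (x : V) : set V :=
  [set v | g x \is a fin_num /\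
    (0 <= limf_einf
      (fun z => (g z - g x - (ip v (z - x))%:E) * (ipnorm ip (z - x))^-1%:E)
      x^')%E].

Definition limiting_subdiff {V : normedModType R} (ip : V -> V -> R)
    (g : V -> \bar R) (x : V) : set V :=
  [set v | g x \is a fin_num /\
    exists z_ v_ : nat -> V,
      [/\ forall k, regular_subdiff ip g (z_ k) (v_ k),
          z_ k @[k --> \oo] --> x,
          g (z_ k) @[k --> \oo] --> g x &
          v_ k @[k --> \oo] --> v]].

Definition regular_normal {V : normedModType R} (ip : V -> V -> R)
    (S : set V) (x : V) : set V :=
  [set v | S x /\
    (limf_esup (fun z => (ip v (z - x) / ipnorm ip (z - x))%:E)
      (within S x^') <= 0)%E].

Definition limiting_normal {V : normedModType R} (ip : V -> V -> R)
    (S : set V) (x : V) : set V :=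
  [set v | S x /\
    exists z_ v_ : nat -> V,
      [/\ forall k, regular_normal ip S (z_ k) (v_ k),
          z_ k @[k --> \oo] --> x &
          v_ k @[k --> \oo] --> v]].

Definition ip_prod {V W : normedModType R} (ipV : V -> V -> R)
    (ipW : W -> W -> R) (p q : V * W) : R := ipV p.1 q.1 + ipW p.2 q.2.

Definition gph {V W : normedModType R} (F : V -> set W) : set (V * W) :=
  [set p | F p.1 p.2].

(* [coderivative ipV ipW F z w v] is the set D^*F(z|w)(v). *)
Definition coderivative {V W : normedModType R} (ipV : V -> V -> R)
    (ipW : W -> W -> R) (F : V -> set W) (z : V) (w v : W) : set V :=
  [set u | limiting_normal (ip_prod ipV ipW) (gph F) (z, w) (u, - v)].

End variational_analysis.

Section spectral_functions.
Context {R : realType} {m n : nat}.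

Definition trace_ip (A B : 'M[R]_(m, n)) : R := \tr (A^T *m B).

(* For m <= n: the nonincreasing vector of the square roots of the m
   eigenvalues, with multiplicity, of X X^T. *)
Definition singular_values (X : 'M[R]_(m, n)) (s : 'rV[R]_m) : Prop :=
  [/\ forall i, 0 <= s 0 i,
      forall i j : 'I_m, (i <= j)%N -> s 0 j <= s 0 i &
      char_poly (X *m X^T) = \prod_(i < m) ('X - (s 0 i ^+ 2)%:P)].

(* The default 0 is never used: such a vector exists and is unique, see
   [sigmaP] and [singular_values_uniq]. *)
Definition sigma (X : 'M[R]_(m, n)) : 'rV[R]_m :=
  xget 0 [set s | singular_values X s].

Definition nuclear_norm (X : 'M[R]_(m, n)) : R := \sum_(i < m) sigma X 0 i.

Definition subdiff_nuclear (X : 'M[R]_(m, n)) : set 'M[R]_(m, n) :=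
  limiting_subdiff trace_ip (fun Y => (nuclear_norm Y)%:E) X.

Definition subdiff_rank (X : 'M[R]_(m, n)) : set 'M[R]_(m, n) :=
  limiting_subdiff trace_ip (fun Y => (\rank Y)%:R%:E) X.

End spectral_functions.

Section singular_values_theory.
Import spectral complex.
Context {R : realType} {m n : nat}.
Implicit Types (X : 'M[R]_(m, n)) (s : 'rV[R]_m).

Lemma char_poly_similar (F : fieldType) (k : nat) (P D : 'M[F]_k) :
  P \in unitmx -> char_poly (invmx P *m D *m P) = char_poly D.
Proof.
move=> uP; rewrite /char_poly.
have -> : char_poly_mx (invmx P *m D *m P) =
    map_mx polyC (invmx P) *m char_poly_mx D *m map_mx polyC P.
  rewrite /char_poly_mx !map_mxM mulmxBr mulmxBl scalar_mxC.
  by rewrite -[X in _ = X - _]mulmxA -(map_mxM polyC (invmx P) P) mulVmx// map_mx1 mulmx1.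
rewrite !det_mulmx mulrAC -det_mulmx -(map_mxM polyC (invmx P) P) mulVmx// map_mx1 det1.
by rewrite mul1r.
Qed.

Lemma char_poly_gram X : exists2 t : seq R, all (>= 0) t &
  char_poly (X *m X^T) = \prod_(x <- t) ('X - x%:P).
Proof.
pose f := real_complex R.
pose A := map_mx f (X *m X^T).
have Asym : A \is symmetricmx.
  apply/is_hermitianmxP; rewrite expr0 scale1r.
  by apply/matrixP => i j; rewrite !mxE; congr f; apply: eq_bigr => k _;
    rewrite !mxE mulrC.
have Areal : A \is a mxOver Num.real.
  by apply/mxOverP => i j; rewrite mxE; apply/complex_realP; eexists.
have Aherm := realsym_hermsym Asym Areal.
have /orthomx_spectralP EA := hermitian_normalmx Aherm.
have uP := spectral_unit A.
have spR := hermitian_spectral_diag_real Aherm.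
set P := spectralmx A in EA uP.
set sp := spectral_diag A in EA spR.
have spE i : sp 0 i = \sum_j `|(P *m map_mx f X) i j| ^+ 2.
  have : diag_mx sp = (P *m map_mx f X) *m (P *m map_mx f X)^t*%sesqui.
    have cX : (map_mx f X)^t*%sesqui = map_mx f X^T.
      by apply/matrixP => a b; rewrite !mxE; apply/CrealP/complex_realP; eexists.
    rewrite trmx_mul map_mxM/= cX mulmxA -(mulmxA P) -map_mxM -/A.
    rewrite -invmx_unitary ?spectral_unitarymx//.
    by rewrite [in RHS]EA -!mulmxA mulmxV// mulmx1 mulKVmx.
  move=> /matrixP/(_ i i); rewrite !mxE eqxx mulr1n => ->.
  by apply: eq_bigr => j _; rewrite !mxE normCK.
have sp0 i : 0 <= sp 0 i.
  by rewrite spE sumr_ge0// => j _; rewrite exprn_ge0.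
exists [seq Re (sp 0 i) | i <- index_enum 'I_m].
  apply/allP => _ /mapP[i _ ->] /=.
  by have := sp0 i; rewrite lecE => /andP[].
apply: (@map_poly_inj _ _ f); rewrite map_char_poly -/A EA.
rewrite char_poly_similar// char_poly_trig ?diag_mx_is_trig//.
rewrite big_map map_prod_XsubC; apply: eq_bigr => i _.
rewrite mxE eqxx mulr1n; congr ('X - _%:P).
by rewrite [RHS]RRe_real// (mxOverP spR).
Qed.

Lemma singular_values_exist X : exists s, singular_values X s.
Proof.
have [t t0 tE] := char_poly_gram X.
have szt : size t = m.
  by have := size_char_poly (X *m X^T); rewrite tE size_prod_XsubC => -[].
pose u := sort >=%O (map Num.sqrt t).
have szu : size u = m by rewrite size_sort size_map.
have us : sorted >=%O u by apply: sort_sorted => x y; exact: le_total.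
exists (\row_i u`_i); split=> [i|i j ij|].
- rewrite mxE; have : u`_i \in u by rewrite mem_nth// szu.
  by rewrite mem_sort => /mapP[x _ ->]; exact: sqrtr_ge0.
- rewrite !mxE.
  have := sorted_leq_nth (rev_trans le_trans) (fun x => lexx x) 0 us.
  by apply; rewrite ?inE ?szu.
- under eq_bigr do rewrite mxE.
  rewrite tE -(big_mkord xpredT (fun i => 'X - (u`_i ^+ 2)%:P)) -szu.
  rewrite -(big_nth 0 xpredT (fun x => 'X - (x ^+ 2)%:P)).
  rewrite [RHS](perm_big (map Num.sqrt t)) ?perm_sort//= big_map.
  rewrite big_seq [RHS]big_seq; apply: eq_bigr => x xt.
  by rewrite sqr_sqrtr// (allP t0).
Qed.

Lemma sigmaP X : singular_values X (sigma X).
Proof.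
by have [s Xs] := singular_values_exist X; exact: (xgetPex 0 (ex_intro _ s Xs)).
Qed.

Lemma singular_values_uniq X s s' :
  singular_values X s -> singular_values X s' -> s = s'.
Proof.
move=> [s0 ss sE] [s0' ss' sE'].
pose l (v : 'rV[R]_m) := [seq v 0 i ^+ 2 | i <- enum 'I_m].
have lE v : \prod_(x <- l v) ('X - x%:P) = \prod_(i < m) ('X - (v 0 i ^+ 2)%:P).
  by rewrite big_map big_enum.
have sl (v : 'rV[R]_m) : (forall i, 0 <= v 0 i) ->
    (forall i j : 'I_m, (i <= j)%N -> v 0 j <= v 0 i) -> sorted >=%O (l v).
  move=> v0 vs; rewrite sorted_map.
  have : sorted (fun i j : 'I_m => (i <= j)%N) (enum 'I_m).
    by have := iota_sorted 0 m; rewrite -val_enum_ord sorted_map.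
  by apply: sub_sorted => i j ij /=; rewrite lerXn2r ?nnegrE// vs.
have ll : l s = l s'.
  apply: (sorted_eq (rev_trans le_trans)) (sl _ s0 ss) (sl _ s0' ss') _.
    by move=> x y /andP[xy yx]; apply/le_anti; rewrite yx xy.
  by apply: prod_XsubC_eq; rewrite !lE -sE -sE'.
apply/rowP => i; apply/eqP; rewrite -(@eqrXn2 _ 2)//; apply/eqP.
by have /eq_in_map := ll; apply; rewrite mem_enum.
Qed.

End singular_values_theory.

Section families.
Context {R : realType}.

Definition ereal_convex (phi : R -> \bar R) : Prop :=
  forall x y t : R, 0 < t < 1 ->
    (phi (t * x + (1 - t) * y)%R <= t%:E * phi x + (1 - t)%:E * phi y)%E.

Definition argmin_on (A : set R) (phi : R -> \bar R) : set R :=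
  [set t | A t /\ forall s, A s -> (phi t <= phi s)%E].

Record family_L (phi : R -> \bar R) : Prop := FamilyL {
  family_L_gtNy : forall t, (-oo < phi t)%E;
  family_L_dom : exists t, (phi t < +oo)%E;
  family_L_lsc : lower_semicontinuous phi;
  family_L_convex : ereal_convex phi;
  family_L_int : `[0, 1] `<=` [set t | phi t < +oo]%E°;
  family_L_1 : phi 1 = 1%E;
  family_L_argmin : exists t0 : R,
    [/\ argmin_on `[0, 1] phi = [set t0], t0 < 1 & phi t0 = 0%E] }.

(* [phi] is finite around each point of ]0, 1], so [fine] does not alter it
   there; the derivative at 1 is two-sided. *)
Definition family_L1 (phi : R -> \bar R) : Prop :=
  family_L phi /\ forall t : R, 0 < t <= 1 -> derivable (fine \o phi) t 1.

Definition phi_hat (phi : R -> \bar R) (t : R) : \bar R := phi `|t|.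

Definition Phi_hat {m : nat} (phi : R -> \bar R) (x : 'rV[R]_m) : \bar R :=
  (\sum_(i < m) phi_hat phi (x 0%R i))%E.

Definition subdiff_phi_hat (phi : R -> \bar R) (t : R) : set R :=
  limiting_subdiff (V := R) (fun x y => x * y) (phi_hat phi) t.

End families.

Section stationarity.
Context {R : realType} {m n : nat}.

Definition subdiff_real (f : 'M[R]_(m, n) -> R) (X : 'M[R]_(m, n)) :=
  limiting_subdiff trace_ip (EFin \o f) X.

Definition R_stationary (nu : R) (f : 'M[R]_(m, n) -> R)
    (Omega : set 'M[R]_(m, n)) (X : 'M[R]_(m, n)) : Prop :=
  exists G H N : 'M[R]_(m, n),
    [/\ subdiff_real f X G, subdiff_rank X H,
        limiting_normal trace_ip Omega X N &
        0 = nu *: G + H + N].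

Definition M_stationary (nu : R) (f : 'M[R]_(m, n) -> R)
    (Omega : set 'M[R]_(m, n)) (phi : R -> \bar R) (X : 'M[R]_(m, n)) : Prop :=
  exists W DW : 'M[R]_(m, n),
    [/\ subdiff_nuclear X W,
        limiting_subdiff trace_ip (Phi_hat phi \o sigma) W DW &
        exists G N D : 'M[R]_(m, n),
          [/\ subdiff_real f X G, limiting_normal trace_ip Omega X N,
              coderivative trace_ip trace_ip subdiff_nuclear X W DW D &
              0 = nu *: G + N + D]].

End stationarity.

(* Main.v *)
Require Import Defs.
From mathcomp Require Import all_boot all_order all_algebra.
From mathcomp Require Import all_classical all_reals all_analysis.
From mathcomp Require Import ring lra.

Set Implicit Arguments.
Unset Strict Implicit.
Unset Printing Implicit Defensive.

Import Order.TTheory GRing.Theory Num.Theory.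
Import numFieldNormedType.Exports.

Local Open Scope classical_set_scope.
Local Open Scope ring_scope.

(** Let [F] be the subdifferential map of the nuclear norm and [<A, B>] the
    trace inner product. Everything rests on two explicit descriptions.

    - [W] belongs to [F X] if and only if [W] is contractive and, for some [C],
      [X = W C C^T] and [W^T W C = C] ([subdiff_nuclearP] and
      [nuclear_dual_pairP]); then [C C^T = W^T X] is the symmetric factor in the
      polar decomposition of [X].
    - [H] belongs to the subdifferential of the rank at [X] if and only if
      [X^T H = 0] and [H X^T = 0] ([subdiff_rankP]): these are the normals at
      [X] of the manifold of matrices of the same rank.

    M-stationarity implies R-stationarity because a coderivative element [u] of
    [F] at [(X, W)] in the direction [v = Delta W] satisfies these two
    equations. The graph of [F] is stable under multiplication of [X] and [W]
    on the same side by one rotation, and under a change of [C] into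
    [C (1 + t N)] with [W] fixed. A regular normal [(u, p)] of the graph is
    nonpositive on the velocities of such curves, so [u X^T + p W^T] and
    [X^T u + W^T p] are symmetric and [X^T u W^T X] is skew. These are
    polynomial identities, hence they pass to limiting normals, where
    [p = - v]. The subgradient [v] of a function of the singular values at [W]
    is orthogonal to the velocities of the rotations of [W], so that [v W^T]
    and [W^T v] are symmetric too. Thus [u X^T] and [X^T u] are symmetric and
    [X^T u W^T X] is skew, which forces [X^T u = 0] and [u X^T = 0]
    ([orthogonality_of_symmetry]).

    Conversely, let [H] be normal to the rank at [X]. Criticality of
    [phi_hat] at [0] forces the minimizer of [phi] on [[0, 1]] to be [0]
    ([phi_hat_critical_at_0]); hence on [[0, +oo[] the function [phi] lies above
    both [0] and a line [1 + c (s - 1)] of slope [c >= 1], which it touches at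
    [0] and [1] respectively ([supporting_line_at_1]). Let [W] be the partial
    isometry of the polar decomposition of [X]. Its singular values are [0] and
    [1], and these bounds make [c W] a subgradient at [W]
    ([surrogate_subgradient]). Finally [(H, - c W)] is a regular normal of the
    graph: [rank X' <= <W', W'>] on the graph, with equality at [(X, W)], so
    near that point the rank is constant, [H] is orthogonal to [X' - X] up to
    second order, and [<W', W'>] is minimal at [W]
    ([nuclear_coderivative_of_rank_normal]). *)

(** * Regular subgradients and normals for a Euclidean inner product *)

Section inner_products.
Context {R : realType}.

(** Both the topology and the inner product enter the definitions of subgradients
    and normals; the last two fields make their neighbourhoods agree, since the
    norm of the space may differ from the one induced by [ip]. *)
Record euclidean {V : normedModType R} (ip : V -> V -> R) : Prop := Euclidean {
  ipC : forall a b, ip a b = ip b a;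
  ipDr : forall a b c, ip a (b + c) = ip a b + ip a c;
  ipZr : forall k a b, ip a (k *: b) = k * ip a b;
  normr_le_ip : forall a, `|a| ^+ 2 <= ip a a;
  ip_le_normr : exists C, forall a, ip a a <= C * `|a| ^+ 2 }.

Context {V : normedModType R} (ip : V -> V -> R) (ipE : euclidean ip).
Implicit Types a b x z v : V.

Lemma ipBr a b c : ip a (b - c) = ip a b - ip a c.
Proof. by rewrite -scaleN1r (ipDr ipE) (ipZr ipE) mulN1r. Qed.

Lemma ip0r a : ip a 0 = 0.
Proof. by rewrite -(subrr 0) ipBr subrr. Qed.

Lemma ip_ge0 a : 0 <= ip a a.
Proof. exact: le_trans (exprn_ge0 _ _) (normr_le_ip ipE _). Qed.

Lemma ipnorm_ge0 a : 0 <= ipnorm ip a.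
Proof. exact: sqrtr_ge0. Qed.

Lemma ipnorm_sqr a : ipnorm ip a ^+ 2 = ip a a.
Proof. by rewrite sqr_sqrtr// ip_ge0. Qed.

Lemma ipnorm0 : ipnorm ip 0 = 0.
Proof. by rewrite /ipnorm ip0r sqrtr0. Qed.

Lemma normr_le_ipnorm a : `|a| <= ipnorm ip a.
Proof.
by rewrite -(@ler_pXn2r _ 2) ?nnegrE ?ipnorm_ge0// ipnorm_sqr normr_le_ip.
Qed.

Lemma ipnorm_gt0 a : a != 0 -> 0 < ipnorm ip a.
Proof. by rewrite -normr_gt0 => /lt_le_trans; apply; exact: normr_le_ipnorm. Qed.

Lemma ipnormZ k a : ipnorm ip (k *: a) = `|k| * ipnorm ip a.
Proof.
rewrite /ipnorm (ipZr ipE) (ipC ipE) (ipZr ipE) mulrA -expr2.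
by rewrite sqrtrM ?sqr_ge0// sqrtr_sqr.
Qed.

Lemma ip_le_mul a b : ip a b <= ipnorm ip a * ipnorm ip b.
Proof.
have sq t : 0 <= ip a a + t * ip a b *+ 2 + t ^+ 2 * ip b b.
  have := ip_ge0 (a + t *: b).
  rewrite (ipDr ipE) (ipZr ipE) ![ip (_ + _) _](ipC ipE) !(ipDr ipE) !(ipZr ipE).
  by rewrite (ipC ipE b a) => h; apply: le_trans h _; lra.
have [->|b0] := eqVneq b 0.
  by rewrite ip0r mulr_ge0 ?ipnorm_ge0.
have [->|a0] := eqVneq a 0.
  by rewrite (ipC ipE) ip0r mulr_ge0 ?ipnorm_ge0.
have bp := ipnorm_gt0 b0; have ap := ipnorm_gt0 a0.
(* for this [t] the first and last terms of the square are equal *)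
have := sq (- (ipnorm ip a / ipnorm ip b)).
rewrite -!ipnorm_sqr sqrrN expr_div_n divfK ?expf_neq0 ?gt_eqF//.
set u := ipnorm ip a in ap *; set w := ipnorm ip b in bp *; set p := ip a b.
have -> : u ^+ 2 + (- (u / w)) * p *+ 2 + u ^+ 2 = (u / w) * (u * w - p) *+ 2.
  by field; rewrite gt_eqF.
by rewrite pmulrn_lge0// pmulr_rge0 ?divr_gt0// subr_ge0.
Qed.

Lemma ipnorm_triangle a b : ipnorm ip (a + b) <= ipnorm ip a + ipnorm ip b.
Proof.
rewrite -(@ler_pXn2r _ 2) ?nnegrE ?addr_ge0 ?ipnorm_ge0//.
rewrite sqrrD !ipnorm_sqr (ipDr ipE) ![ip (_ + _) _](ipC ipE) !(ipDr ipE).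
rewrite (ipC ipE b a).
have := ip_le_mul a b; lra.
Qed.

Lemma nbhs_ipnorm x (d : R) : 0 < d -> \forall z \near x, ipnorm ip (z - x) < d.
Proof.
move=> d0; have [C hC] := ip_le_normr ipE.
pose e := d / (1 + `|C|).
have C0 : 0 < 1 + `|C| by rewrite ltr_wpDr.
have e0 : 0 < e by rewrite divr_gt0.
apply: filterS (nbhs_ball_norm x (PosNum e0)) => z /= xz.
rewrite -(@ltr_pXn2r _ 2) ?nnegrE ?ipnorm_ge0 ?ltW// ipnorm_sqr.
apply: (le_lt_trans (hC _)).
have xz2 : `|z - x| ^+ 2 < e ^+ 2.
  by rewrite ltr_pXn2r ?nnegrE ?normr_ge0 ?(ltW e0)// distrC.
have h1 : C * `|z - x| ^+ 2 <= (1 + `|C|) ^+ 2 * `|z - x| ^+ 2.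
  apply: ler_wpM2r; first exact: exprn_ge0.
  by have := ler_norm C; have := normr_ge0 C; nra.
apply: (le_lt_trans h1).
have -> : d ^+ 2 = (1 + `|C|) ^+ 2 * e ^+ 2.
  by rewrite -exprMn /e mulrCA divff ?mulr1// gt_eqF.
by rewrite ltr_pM2l// exprn_gt0.
Qed.

End inner_products.

Section variational_criteria.
Context {R : realType} {V : normedModType R} (ip : V -> V -> R).
Hypothesis ipE : euclidean ip.
Implicit Types (g : V -> \bar R) (S : set V) (x z v d : V).

Lemma regular_subdiff_near g x v : regular_subdiff ip g x v ->
  forall e : R, 0 < e -> \forall z \near x,
    (g x + (ip v (z - x) - e * ipnorm ip (z - x))%:E <= g z)%E.
Proof.
move=> [gx]; rewrite limf_einfE => h e e0.
have : ((- e)%:E < ereal_sup [set ereal_inf ((fun z =>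
    ((g z - g x - (ip v (z - x))%:E) * (ipnorm ip (z - x))^-1%:E)%E) @` W) |
    W in x^'])%E.
  by apply: lt_le_trans h; rewrite lte_fin oppr_lt0.
move=> /ereal_sup_gt[_ [W xW <-] hW].
have {}xW : \forall z \near x, z != x -> W z := xW.
apply: filterS xW => z Wz.
have [->|zx] := eqVneq z x.
  by rewrite subrr (ip0r ipE) (ipnorm0 ipE) mulr0 subr0 adde0.
have q0 : 0 < ipnorm ip (z - x) by rewrite (ipnorm_gt0 ipE)// subr_eq0.
have /ltW : ((- e)%:E < (g z - g x - (ip v (z - x))%:E) *
    (ipnorm ip (z - x))^-1%:E)%E.
  by apply: (lt_le_trans hW); apply: ereal_inf_lbound; exists z => //; exact: Wz.
rewrite -(fineK gx).
case: (g z) => [r| |].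
- by rewrite -!EFinB -EFinM -EFinD !lee_fin ler_pdivlMr//; lra.
- by move=> _; rewrite leey.
- by rewrite /= mulNyr gtr0_sg ?invr_gt0// mul1e leeNy_eq.
Qed.

Lemma regular_normal_near S x v : regular_normal ip S x v ->
  forall e : R, 0 < e -> \forall z \near x,
    S z -> ip v (z - x) <= e * ipnorm ip (z - x).
Proof.
move=> [Sx]; rewrite limf_esupE => h e e0.
have : (ereal_inf [set ereal_sup ((fun z =>
    (ip v (z - x) / ipnorm ip (z - x))%:E) @` W) |
    W in within S x^'] < e%:E)%E.
  by apply: le_lt_trans h _; rewrite lte_fin.
move=> /ereal_inf_lt[_ [W xW <-] hW].
have {}xW : \forall z \near x, z != x -> S z -> W z := xW.
apply: filterS xW => z Wz Sz.
have [->|zx] := eqVneq z x.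
  by rewrite subrr (ip0r ipE) (ipnorm0 ipE) mulr0.
have q0 : 0 < ipnorm ip (z - x) by rewrite (ipnorm_gt0 ipE)// subr_eq0.
have : ((ip v (z - x) / ipnorm ip (z - x))%:E < e%:E)%E.
  by apply: (le_lt_trans _ hW); apply: ereal_sup_ubound; exists z => //; exact: Wz.
by rewrite lte_fin ltr_pdivrMr// => /ltW.
Qed.

(** The error [K |z - x|^2] is negligible against [|z - x|], whatever the sign of
    [K]. All the subgradients exhibited below are of this proximal kind. *)
Lemma regular_subdiff_quadratic g x v (K : R) : g x \is a fin_num ->
  (\forall z \near x,
    (g x + (ip v (z - x) - K * ipnorm ip (z - x) ^+ 2)%:E <= g z)%E) ->
  regular_subdiff ip g x v.
Proof.
move=> gx h; split=> //; rewrite limf_einfE.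
apply/lee_addgt0Pr => e e0; rewrite -leeBlDr// sub0e.
pose d := e / (1 + `|K|).
have K0 : 0 < 1 + `|K| by rewrite ltr_wpDr.
have d0 : 0 < d by rewrite divr_gt0.
pose W := [set z | z != x /\ ipnorm ip (z - x) < d /\
  (g x + (ip v (z - x) - K * ipnorm ip (z - x) ^+ 2)%:E <= g z)%E].
apply: le_trans (ereal_sup_ubound _); last first.
  exists W; last reflexivity.
  rewrite /dnbhs /within /= /W.
  by apply: filterS2 (nbhs_ipnorm ipE x d0) h => z ? ? ?; split.
apply: le_ereal_inf_tmp => _ [z [zx [zd hz]] <-].
have q0 : 0 < ipnorm ip (z - x) by rewrite (ipnorm_gt0 ipE)// subr_eq0.
move: hz; rewrite -(fineK gx); case: (g z) => [r| |].
- rewrite -!EFinB -EFinD -EFinM !lee_fin ler_pdivlMr// => hz.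
  have h1 : K * ipnorm ip (z - x) ^+ 2 <= e * ipnorm ip (z - x).
    rewrite expr2 mulrA ler_pM2r//.
    have -> : e = (1 + `|K|) * d by rewrite /d mulrCA divff ?mulr1// gt_eqF.
    have := ler_norm K; have := normr_ge0 K; nra.
  lra.
- by move=> _; rewrite /= mulyr gtr0_sg ?invr_gt0// mul1e leey.
- by rewrite leeNy_eq.
Qed.

Lemma regular_normal_quadratic S x v (K : R) : S x ->
  (\forall z \near x, S z -> ip v (z - x) <= K * ipnorm ip (z - x) ^+ 2) ->
  regular_normal ip S x v.
Proof.
move=> Sx h; split=> //; rewrite limf_esupE.
apply/lee_addgt0Pr => e e0; rewrite add0e.
pose d := e / (1 + `|K|).
have K0 : 0 < 1 + `|K| by rewrite ltr_wpDr.
have d0 : 0 < d by rewrite divr_gt0.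
pose W := [set z | z != x /\ ipnorm ip (z - x) < d /\
  ip v (z - x) <= K * ipnorm ip (z - x) ^+ 2].
apply: (le_trans (ereal_inf_lbound _)).
  exists W; last reflexivity.
  rewrite /dnbhs /within /= /W.
  apply: filterS2 (nbhs_ipnorm ipE x d0) h => z zd zK zx Sz.
  by split=> //; split=> //; exact: zK.
apply: ge_ereal_sup => _ [z [zx [zd hz]] <-].
have q0 : 0 < ipnorm ip (z - x) by rewrite (ipnorm_gt0 ipE)// subr_eq0.
rewrite lee_fin ler_pdivrMr//; apply: (le_trans hz).
rewrite expr2 mulrA ler_pM2r//.
have -> : e = (1 + `|K|) * d by rewrite /d mulrCA divff ?mulr1// gt_eqF.
have := ler_norm K; have := normr_ge0 K; nra.
Qed.

(** A first-order estimate at [x] can be tested along any curve that starts at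
    [x] and has velocity [d], up to an error quadratic in the time. The relation
    [T z s] stands for [g z <= g x + s] when subgradients are tested and for
    [z] in the set, with [s = 0], when normals are. *)
Lemma first_order_curve (T : V -> R -> Prop) x v d (b tau C : R) :
  (forall e : R, 0 < e -> \forall z \near x, forall s, T z s ->
     ip v (z - x) <= s + e * ipnorm ip (z - x)) ->
  0 < tau ->
  (forall t : R, 0 < t < tau ->
     exists z, ipnorm ip (z - x - t *: d) <= C * t ^+ 2 /\ T z (t * b)) ->
  ip v d <= b.
Proof.
move=> Tx tau0 curve; rewrite leNgt; apply/negP => bd.
pose a := ip v d - b.
have a0 : 0 < a by rewrite subr_gt0.
pose D := ipnorm ip d.
have D0 : 0 <= D := ipnorm_ge0 _ _.
pose Q := ipnorm ip v.
have Q0 : 0 <= Q := ipnorm_ge0 _ _.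
pose C' := `|C|.
have C0 : 0 <= C' := normr_ge0 _.
pose e := a / (4 * (D + 1)).
have e0 : 0 < e by rewrite divr_gt0//; lra.
have [r /= r0 hr] : nbhs_ball_ (ball_ Num.norm) x
    [set z | forall s, T z s -> ip v (z - x) <= s + e * ipnorm ip (z - x)].
  by rewrite nbhs_nbhs_norm; exact: Tx.
pose t := Num.min (tau / 2) (Num.min (r / (2 * (D + 1)))
  (Num.min (1 / (C' + 1)) (a / (4 * (Q + 1) * (C' + 1))))).
have t0 : 0 < t by rewrite !lt_min !divr_gt0//; try lra; rewrite !mulr_gt0//; lra.
have t1 : t < tau.
  by apply: (@le_lt_trans _ _ (tau / 2)); [rewrite ge_min lexx|lra].
have t2 : t * (2 * (D + 1)) <= r.
  by rewrite -ler_pdivlMr ?ge_min ?lexx ?orbT//; lra.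
have t3 : t * (C' + 1) <= 1.
  by rewrite -ler_pdivlMr ?ge_min ?lexx ?orbT//; lra.
have t4 : t * (4 * (Q + 1) * (C' + 1)) <= a.
  by rewrite -ler_pdivlMr ?ge_min ?lexx ?orbT//; rewrite !mulr_gt0//; lra.
have [|z [zx Tz]] := curve t; first by rewrite t0.
have zx' : ipnorm ip (z - x - t *: d) <= C' * t ^+ 2.
  by apply: (le_trans zx); rewrite ler_wpM2r ?sqr_ge0// ler_norm.
have Ct : C' * t ^+ 2 <= t by nra.
have zxn : ipnorm ip (z - x) <= t * (D + 1).
  rewrite -(subrK (t *: d) (z - x)).
  apply: (le_trans (ipnorm_triangle ipE _ _)).
  by rewrite (ipnormZ ipE) gtr0_norm// -/D; lra.
have := hr z; rewrite /ball_ /= => /(_ _ _ Tz) h.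
have {}h : ip v (z - x) <= t * b + e * ipnorm ip (z - x).
  apply: h; rewrite distrC; apply: le_lt_trans (normr_le_ipnorm ipE _) _.
  apply: (le_lt_trans zxn); nra.
have h2 : t * ip v d - Q * (C' * t ^+ 2) <= ip v (z - x).
  have -> : z - x = t *: d - (t *: d - (z - x)) by rewrite opprB [RHS]addrC subrK.
  rewrite (ipBr ipE) (ipZr ipE) lerB// ; apply: le_trans (ip_le_mul ipE _ _) _.
  rewrite ler_wpM2l//.
  by rewrite -opprB -scaleN1r (ipnormZ ipE) normrN1 mul1r.
have h3 : e * ipnorm ip (z - x) <= t * (a / 4).
  apply: (@le_trans _ _ (e * (t * (D + 1)))); first by rewrite ler_wpM2l// ltW.
  rewrite /e le_eqVlt; apply/orP; left; apply/eqP.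
  by field; rewrite gt_eqF//; lra.
have h4 : Q * (C' * t ^+ 2) <= t * (a / 4).
  have : Q * (C' * t) <= a / 4.
    have : Q * (C' * t) <= (Q + 1) * (C' + 1) * t.
      rewrite mulrA ler_wpM2r ?ltW//; nra.
    lra.
  by rewrite expr2 => /(ler_wpM2l (ltW t0)); lra.
have : t * a <= t * (a / 2) by rewrite /a in h3 h4 *; lra.
by rewrite ler_pM2l//; lra.
Qed.

Lemma regular_subdiff_curve g x v d (b tau C : R) :
  regular_subdiff ip g x v -> 0 < tau ->
  (forall t : R, 0 < t < tau -> exists z,
     ipnorm ip (z - x - t *: d) <= C * t ^+ 2 /\ (g z <= g x + (t * b)%:E)%E) ->
  ip v d <= b.
Proof.
move=> gv; have [gx _] := gv.
apply: (first_order_curve (T := fun z s => (g z <= g x + s%:E)%E)) => e e0.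
apply: filterS (regular_subdiff_near gv e0) => z hz s /(le_trans hz).
by rewrite leeD2lE// lee_fin; lra.
Qed.

Lemma regular_normal_curve S x v d (tau C : R) :
  regular_normal ip S x v -> 0 < tau ->
  (forall t : R, 0 < t < tau -> exists z,
     ipnorm ip (z - x - t *: d) <= C * t ^+ 2 /\ S z) ->
  ip v d <= 0.
Proof.
move=> Sv tau0 curve.
apply: (@first_order_curve (fun z s => S z /\ s = 0) x v d 0 tau C) => //.
  move=> e e0; apply: filterS (regular_normal_near Sv e0) => z hz s [Sz ->].
  by rewrite add0r; exact: hz.
by move=> t /curve[z [? ?]]; exists z; split=> //; rewrite mulr0.
Qed.

Lemma regular_limiting_subdiff g x :
  regular_subdiff ip g x `<=` limiting_subdiff ip g x.
Proof.
move=> v gv; split; first by case: gv.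
by exists (fun=> x), (fun=> v); split=> //; exact: cvg_cst.
Qed.

Lemma regular_limiting_normal S x :
  regular_normal ip S x `<=` limiting_normal ip S x.
Proof.
move=> v Sv; split; first by case: Sv.
by exists (fun=> x), (fun=> v); split=> //; exact: cvg_cst.
Qed.

End variational_criteria.

(** * The trace inner product *)

Section trace_inner_product.
Context {R : realType}.

Lemma trace_ipE m n (A B : 'M[R]_(m, n)) :
  trace_ip A B = \sum_j \sum_i A i j * B i j.
Proof.
rewrite /trace_ip /mxtrace; apply: eq_bigr => j _; rewrite mxE.
by apply: eq_bigr => i _; rewrite mxE.
Qed.

Lemma trace_ipC m n (A B : 'M[R]_(m, n)) : trace_ip A B = trace_ip B A.
Proof. by rewrite /trace_ip -mxtrace_tr trmx_mul trmxK. Qed.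

Lemma trace_ipDr m n (A B C : 'M[R]_(m, n)) :
  trace_ip A (B + C) = trace_ip A B + trace_ip A C.
Proof. by rewrite /trace_ip mulmxDr mxtraceD. Qed.

Lemma trace_ipZr m n k (A B : 'M[R]_(m, n)) :
  trace_ip A (k *: B) = k * trace_ip A B.
Proof. by rewrite /trace_ip -scalemxAr mxtraceZ. Qed.

Lemma trace_ipBr m n (A B C : 'M[R]_(m, n)) :
  trace_ip A (B - C) = trace_ip A B - trace_ip A C.
Proof. by rewrite trace_ipDr -scaleN1r trace_ipZr mulN1r. Qed.

Lemma trace_ipBl m n (A B C : 'M[R]_(m, n)) :
  trace_ip (A - B) C = trace_ip A C - trace_ip B C.
Proof. by rewrite trace_ipC trace_ipBr !(trace_ipC C). Qed.

Lemma trace_ipDl m n (A B C : 'M[R]_(m, n)) :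
  trace_ip (A + B) C = trace_ip A C + trace_ip B C.
Proof. by rewrite trace_ipC trace_ipDr !(trace_ipC C). Qed.

Lemma trace_ipZl m n k (A B : 'M[R]_(m, n)) :
  trace_ip (k *: A) B = k * trace_ip A B.
Proof. by rewrite trace_ipC trace_ipZr trace_ipC. Qed.

Lemma trace_ip_mull m n p (M : 'M[R]_(m, n)) (A : 'M[R]_(n, p)) B :
  trace_ip (M *m A) B = trace_ip A (M^T *m B).
Proof. by rewrite /trace_ip trmx_mul mulmxA. Qed.

Lemma trace_ip_mulr m n p (A : 'M[R]_(m, n)) (M : 'M[R]_(n, p)) B :
  trace_ip (A *m M) B = trace_ip A (B *m M^T).
Proof. by rewrite /trace_ip trmx_mul -mulmxA mxtrace_mulC mulmxA. Qed.

Lemma trace_ip_mul_tr m n p (W : 'M[R]_(m, n)) (A : 'M[R]_(m, p))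
    (B : 'M[R]_(n, p)) :
  trace_ip W (A *m B^T) = trace_ip (W *m B) A.
Proof. by rewrite trace_ip_mulr. Qed.

Lemma trace_ip_tr m n (A B : 'M[R]_(m, n)) : trace_ip A^T B^T = trace_ip A B.
Proof.
by rewrite /trace_ip trmxK mxtrace_mulC -mxtrace_tr trmx_mul trmxK.
Qed.

Lemma trace_ip_sqrE m n (A : 'M[R]_(m, n)) :
  trace_ip A A = \sum_j \sum_i A i j ^+ 2.
Proof.
by rewrite trace_ipE; apply: eq_bigr => j _; apply: eq_bigr => i _; rewrite expr2.
Qed.

Lemma sqr_entry_le_trace_ip m n (A : 'M[R]_(m, n)) i j :
  A i j ^+ 2 <= trace_ip A A.
Proof.
rewrite trace_ip_sqrE (bigD1 j)//= (bigD1 i)//= -addrA lerDl.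
by rewrite addr_ge0// sumr_ge0// => k _; rewrite ?sumr_ge0// => *; rewrite sqr_ge0.
Qed.

Lemma trace_ip_euclidean m n : euclidean (@trace_ip R m n).
Proof.
split=> [||||].
- exact: trace_ipC.
- exact: trace_ipDr.
- move=> k A B; exact: trace_ipZr.
- move=> A; have [->|A0] := eqVneq A 0.
    rewrite normr0 expr0n/= trace_ip_sqrE sumr_ge0// => j _.
    by rewrite sumr_ge0// => i _; rewrite sqr_ge0.
  have : mx_norm A != 0 by apply: contra_neq A0 => /mx_norm_eq0.
  move=> /mx_norm_neq0[[i j]] /= Aij.
  rewrite [`|A|]Aij -normrX ger0_norm ?sqr_ge0//; exact: sqr_entry_le_trace_ip.
- exists (n%:R * m%:R) => A; rewrite trace_ip_sqrE.
  have h j i : A i j ^+ 2 <= `|A| ^+ 2.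
    rewrite -[leLHS]ger0_norm ?sqr_ge0// normrX ler_pXn2r ?nnegrE ?normr_ge0//.
    rewrite [`|A|]mx_normrE.
    exact: (le_bigmax (0 : R) (fun ij : 'I_m * 'I_n => `|A ij.1 ij.2|) (i, j)).
  apply: (@le_trans _ _ (\sum_(j < n) \sum_(i < m) `|A| ^+ 2)).
    by apply: ler_sum => j _; apply: ler_sum => i _; exact: h.
  by rewrite !sumr_const !card_ord -[leRHS]mulrA !mulr_natl.
Qed.

Lemma trace_ip_ge0 m n (A : 'M[R]_(m, n)) : 0 <= trace_ip A A.
Proof. exact: ip_ge0 (trace_ip_euclidean m n) A. Qed.

Lemma trace_ip_eq0 m n (A : 'M[R]_(m, n)) : trace_ip A A <= 0 -> A = 0.
Proof.
move=> A0; apply/eqP; rewrite -normr_le0 -(@ler_pXn2r _ 2) ?nnegrE//.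
by rewrite expr0n/=; apply: le_trans A0; exact: normr_le_ip (trace_ip_euclidean m n) A.
Qed.

Lemma trace_ip_sqrB m n (A B : 'M[R]_(m, n)) :
  trace_ip (A - B) (A - B) = trace_ip A A - trace_ip A B *+ 2 + trace_ip B B.
Proof. rewrite trace_ipBl !trace_ipBr (trace_ipC B A); lra. Qed.

Lemma trace_ip_amgm m n (A B : 'M[R]_(m, n)) :
  trace_ip A B *+ 2 <= trace_ip A A + trace_ip B B.
Proof. have := trace_ip_ge0 (A - B); rewrite trace_ip_sqrB; lra. Qed.

Lemma ip_prod_euclidean (V W : normedModType R) (ipV : V -> V -> R)
  (ipW : W -> W -> R) : euclidean ipV -> euclidean ipW ->
  euclidean (ip_prod ipV ipW).
Proof.
move=> hV hW; split; rewrite /ip_prod.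
- by move=> a b; rewrite (ipC hV) (ipC hW).
- by move=> a b c /=; rewrite (ipDr hV) (ipDr hW) addrACA.
- by move=> k a b /=; rewrite (ipZr hV) (ipZr hW) mulrDr.
- move=> [a b] /=.
  have ha := normr_le_ip hV a; have hb := normr_le_ip hW b.
  have a0 := ip_ge0 hV a; have b0 := ip_ge0 hW b.
  rewrite [`|(a, b)|]prod_normE /=; rewrite maxEle; case: ifP => _; lra.
- have [CV hCV] := ip_le_normr hV; have [CW hCW] := ip_le_normr hW.
  exists (`|CV| + `|CW|) => -[a b] /=.
  have la : `|a| <= `|(a, b)| by rewrite [leRHS]prod_normE le_max lexx.
  have lb : `|b| <= `|(a, b)| by rewrite [leRHS]prod_normE le_max lexx orbT.
  have bnd (C x : R) : 0 <= x ->
      x <= `|(a, b)| -> C * x ^+ 2 <= `|C| * `|(a, b)| ^+ 2.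
    move=> x0 xab; apply: (@le_trans _ _ (`|C| * x ^+ 2)).
      by rewrite ler_wpM2r ?sqr_ge0// ler_norm.
    by rewrite ler_wpM2l// ler_pXn2r ?nnegrE ?(le_trans x0 xab).
  rewrite mulrDl; apply: lerD.
    by apply: (le_trans (hCV a)); exact: bnd.
  by apply: (le_trans (hCW b)); exact: bnd.
Qed.

Lemma mulr_euclidean : euclidean (fun x y : R => x * y).
Proof.
split=> [x y|x y z|k x y|x|].
- exact: mulrC.
- exact: mulrDr.
- exact: mulrCA.
- by rewrite -normrX ger0_norm ?sqr_ge0// expr2.
- by exists 1 => x; rewrite mul1r -normrX ger0_norm ?sqr_ge0// expr2.
Qed.

End trace_inner_product.

(** * Real singular value decomposition *)

Section singular_value_decomposition.
Context {R : realType}.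

(** The reflection that exchanges [w] and the first basis vector. *)
Lemma householder n (w : 'rV[R]_(1 + n)) : w *m w^T = 1%:M ->
  exists H : 'M[R]_(1 + n), [/\ H^T = H, H *m H = 1%:M &
    w *m H = row_mx 1%:M 0].
Proof.
move=> w1; pose e : 'rV[R]_(1 + n) := row_mx 1%:M 0.
have e1 : e *m e^T = 1%:M.
  by rewrite /e tr_row_mx mul_row_col trmx1 mulmx1 mul0mx addr0.
pose u := w - e.
have [u0|u0] := eqVneq u 0.
  exists 1%:M; split; rewrite ?trmx1 ?mulmx1//.
  by apply/eqP; rewrite -subr_eq0 -/e -/u u0.
pose q := trace_ip u u.
have q0 : q != 0.
  by apply: contra_neq u0 => q0; apply: trace_ip_eq0; rewrite -/q q0.
have uu : u *m u^T = q%:M.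
  by rewrite [LHS]mx11_scalar; congr _%:M; rewrite /q /trace_ip mxtrace_mulC trace_mx11.
exists (1%:M - (2 / q) *: (u^T *m u)); split.
- by rewrite linearB linearZ/= trmx1 trmx_mul trmxK.
- rewrite mulmxBr mulmx1 mulmxBl mul1mx -scalemxAl -scalemxAr.
  rewrite -[_ *m _ *m _]mulmxA (mulmxA u) uu mul_scalar_mx -scalemxAr !scalerA.
  move: (u^T *m u) => P; apply/matrixP => i j; rewrite !mxE.
  by field.
- rewrite mulmxBr mulmx1 -scalemxAr mulmxA.
  have wu : w *m u^T = (q / 2)%:M.
    have qE : q%:M = 1%:M + 1%:M - (w *m e^T + e *m w^T).
      rewrite -uu /u linearB/= mulmxBr !mulmxBl w1 e1.
      by rewrite !opprB !opprD; apply/matrixP => i j; rewrite !mxE; ring.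
    have ew : e *m w^T = w *m e^T.
      by rewrite -[LHS]trmxK trmx_mul trmxK [LHS]mx11_scalar [RHS]mx11_scalar mxE.
    rewrite linearB/= mulmxBr w1; move: qE; rewrite ew => /matrixP/(_ 0 0).
    rewrite !mxE /= !mulr1n => qE; apply/matrixP => i j; rewrite !ord1 !mxE/= !mulr1n qE.
    by field.
  rewrite wu mul_scalar_mx scalerA (_ : 2 / q * (q / 2) = 1) ?scale1r; last by field.
  by rewrite /u opprB addrC subrK.
Qed.

(** The eigenvalues are given, in an arbitrary order, so only deflation remains:
    a reflection moves a unit eigenvector of [d 0 0] to the first basis vector,
    and symmetry then splits off a block of size one. *)
Lemma symmetric_diagonalization n (A : 'M[R]_n) (d : 'rV[R]_n) :
  A^T = A -> char_poly A = \prod_(i < n) ('X - (d 0 i)%:P) ->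
  exists2 U : 'M[R]_n, U^T *m U = 1%:M & A = U *m diag_mx d *m U^T.
Proof.
elim: n A d => [|n IHn] A d AT Ad.
  by exists 1%:M; rewrite ?trmx1 ?mulmx1//; apply/matrixP => -[].
have : eigenvalue A (d 0 0).
  rewrite eigenvalue_root_char Ad big_ord_recl rootE hornerM.
  by rewrite hornerXsubC subrr mul0r.
move=> /eigenvalueP[v vA v0].
pose q := trace_ip v v.
have q0 : 0 < q.
  rewrite lt_def trace_ip_ge0 andbT; apply: contra_neq v0 => q0.
  by apply: trace_ip_eq0; rewrite -/q q0.
pose w : 'rV[R]_(1 + n) := (Num.sqrt q)^-1 *: v.
have w1 : w *m w^T = 1%:M.
  rewrite /w linearZ/= -scalemxAl -scalemxAr scalerA.
  rewrite [v *m _]mx11_scalar -trace_mx11 mxtrace_mulC -/(trace_ip v v) -/q.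
  rewrite scale_scalar_mx -expr2 exprVn sqr_sqrtr ?ltW// mulVf ?gt_eqF//.
have wA : w *m A = d 0 0 *: w by rewrite -scalemxAl vA scalerA mulrC -scalerA.
have [H [HT HH wH]] := householder w1.
pose e : 'rV[R]_(1 + n) := row_mx 1%:M 0.
pose B : 'M[R]_(1 + n) := H *m A *m H.
have BT : B^T = B by rewrite /B !trmx_mul HT AT mulmxA.
have AE : A = H *m B *m H.
  by rewrite /B !mulmxA HH mul1mx -!mulmxA HH mulmx1.
have eB : e *m B = d 0 0 *: e.
  have -> : e *m B = w *m A *m H.
    by rewrite /e -wH /B -!mulmxA [H *m (H *m _)]mulmxA HH mul1mx.
  by rewrite wA -scalemxAl wH.
pose B' : 'M[R]_n := drsubmx B.
have BE : B = block_mx (d 0 0)%:M 0 0 B'.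
  have eBE : row_mx (ulsubmx B) (ursubmx B) = row_mx (d 0 0)%:M 0.
    have := eB; rewrite -{1}(submxK B) /e mul_row_block !mul1mx !mul0mx !addr0.
    by rewrite scale_row_mx scaler0 scale_scalar_mx mulr1.
  have [ul ur] := eq_row_mx eBE.
  rewrite -[LHS](submxK B) ul ur; congr block_mx.
  by rewrite -[dlsubmx B]trmxK trmx_dlsub BT ur trmx0.
have uH : H \in unitmx by case: (mulmx1_unit HH).
have HV : invmx H = H by rewrite -[invmx H]mulmx1 -HH mulmxA mulVmx// mul1mx.
have B'T : B'^T = B' by rewrite /B' trmx_drsub BT.
have cB : @char_poly R (1 + n) B = ('X - (d 0 0)%:P) * char_poly B'.
  rewrite BE /char_poly char_block_diag_mx det_ublock.
  by congr (_ * _); rewrite det_mx11 !mxE /= mulr1n.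
have : char_poly A = ('X - (d 0 0)%:P) * char_poly B'.
  by rewrite -cB [in LHS]AE -{1}HV char_poly_similar.
rewrite Ad big_ord_recl/= => /mulfI; rewrite polyXsubC_eq0 => /(_ isT) B'd.
pose d' : 'rV[R]_n := \row_i d 0 (lift ord0 i).
have [|U' U'U BU] := IHn B' d' B'T.
  by rewrite -B'd; apply: eq_bigr => i _; rewrite mxE.
pose K : 'M[R]_(1 + n) := block_mx 1%:M 0 0 U'.
have KT : K^T = block_mx 1%:M 0 0 U'^T by rewrite tr_block_mx !trmx0 trmx1.
have KK : K^T *m K = 1%:M.
  rewrite KT mulmx_block !mulmx0 !mul0mx mulmx1 U'U !addr0 add0r.
  by rewrite -scalar_mx_block.
have dE : @diag_mx R (1 + n) d = block_mx (d 0 0)%:M 0 0 (diag_mx d').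
  rewrite -[d in LHS](@hsubmxK _ 1 1 n) diag_mx_row; congr block_mx.
    by apply/matrixP => i j; rewrite !ord1 !mxE /=; congr (d _ _ *+ _); exact/val_inj.
  by congr diag_mx; apply/rowP => i; rewrite !mxE; congr (d _ _); exact/val_inj.
have KdK : K *m @diag_mx R (1 + n) d *m K^T = B.
  rewrite BE BU KT dE !mulmx_block.
  by rewrite !(mulmx0, mul0mx, addr0, add0r, mulmx1, mul1mx).
exists (H *m K).
  by rewrite trmx_mul HT -mulmxA (mulmxA H) HH mul1mx.
by rewrite AE -KdK trmx_mul HT !mulmxA.
Qed.

Variables (m n : nat).
Implicit Types X : 'M[R]_(m, n).

Lemma sigma_ge0 X i : 0 <= sigma X 0 i.
Proof. by have [] := sigmaP X. Qed.

(** A thin decomposition: the columns of [V] for zero singular values are zero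
    instead of being completed to an orthonormal family, which would only be
    possible for [m <= n]. *)
Lemma svd X : exists U : 'M[R]_m, exists V : 'M[R]_(n, m),
  let e := \row_i (sigma X 0 i != 0)%:R in
  [/\ U^T *m U = 1%:M, X = U *m diag_mx (sigma X) *m V^T,
      V^T *m V = diag_mx e & V *m diag_mx e = V].
Proof.
have [s0 _ Xs] := sigmaP X; set s := sigma X in s0 Xs *.
pose d : 'rV[R]_m := \row_i s 0 i ^+ 2.
have [||U UU XXE] := @symmetric_diagonalization m (X *m X^T) d.
- by rewrite trmx_mul trmxK.
- by rewrite Xs; apply: eq_bigr => i _; rewrite mxE.
have UU' : U *m U^T = 1%:M by exact: mulmx1C.
have UX : (U^T *m X) *m (X^T *m U) = diag_mx d.
  by rewrite mulmxA -(mulmxA U^T) XXE !mulmxA UU mul1mx -mulmxA UU mulmx1.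
pose si : 'rV[R]_m := \row_i (s 0 i)^-1.
pose e : 'rV[R]_m := \row_i (s 0 i != 0)%:R.
have ed : diag_mx e *m diag_mx d = diag_mx d.
  rewrite mulmx_diag; congr diag_mx; apply/rowP => i; rewrite !mxE.
  by have [->|_] := eqVneq (s 0 i) 0; rewrite ?mul1r// expr0n mulr0.
have eUX : diag_mx e *m (U^T *m X) = U^T *m X.
  apply/esym/subr0_eq; apply: trace_ip_eq0; rewrite /trace_ip mxtrace_mulC.
  rewrite -[X in X - _]mul1mx -mulmxBl trmx_mul [(U^T *m X)^T]trmx_mul trmxK.
  rewrite -(mulmxA (1%:M - _)) (mulmxA (U^T *m X)) UX mulmxA mulmxBl mul1mx ed subrr.
  by rewrite mul0mx mxtrace0.
exists U, (X^T *m U *m diag_mx si) => /=; rewrite -/e.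
have VT : (X^T *m U *m diag_mx si)^T = diag_mx si *m (U^T *m X).
  by rewrite !trmx_mul tr_diag_mx trmxK.
split=> //.
- have sis : diag_mx s *m diag_mx si = diag_mx e.
    rewrite mulmx_diag; congr diag_mx; apply/rowP => i; rewrite !mxE.
    by have [->|s_neq0] := eqVneq (s 0 i) 0; rewrite ?mul0r ?divff.
  by rewrite VT mulmxA -(mulmxA U) sis -mulmxA eUX mulmxA UU' mul1mx.
- rewrite VT -(mulmxA _ (U^T *m X)) (mulmxA (U^T *m X) (X^T *m U)) UX.
  rewrite !mulmx_diag; congr diag_mx.
  apply/rowP => i; rewrite !mxE.
  have [->|s_neq0] := eqVneq (s 0 i) 0; first by rewrite invr0 !mul0r.
  by rewrite expr2 mulfK// mulVf.
- rewrite -mulmxA mulmx_diag; congr (_ *m diag_mx _); apply/rowP => i.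
  rewrite !mxE; have [->|_] := eqVneq (s 0 i) 0; last by rewrite mulr1.
  by rewrite invr0 mul0r.
Qed.

End singular_value_decomposition.

(** * Duality for the nuclear norm *)

Section entrywise_convergence.
Context {R : realType}.

(** Convergence of the entries, which is what products of matrices of varying
    shapes preserve by elementary means. *)
Definition mx_cvg m n (A_ : nat -> 'M[R]_(m, n)) (A : 'M[R]_(m, n)) : Prop :=
  forall i j, A_ k i j @[k --> \oo] --> A i j.

Lemma cvg_mx_cvg m n (A_ : nat -> 'M[R]_(m, n)) A :
  A_ k @[k --> \oo] --> A -> mx_cvg A_ A.
Proof.
move=> AA i j.
exact: (continuous_cvg _ (@coord_continuous R m n i j A) AA).
Qed.

Lemma mx_cvg_tr m n (A_ : nat -> 'M[R]_(m, n)) A :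
  mx_cvg A_ A -> mx_cvg (fun k => (A_ k)^T) A^T.
Proof.
move=> AA i j; rewrite mxE; under eq_fun do rewrite mxE; exact: AA.
Qed.

Lemma mx_cvgD m n (A_ B_ : nat -> 'M[R]_(m, n)) A B :
  mx_cvg A_ A -> mx_cvg B_ B -> mx_cvg (fun k => A_ k + B_ k) (A + B).
Proof.
move=> AA BB i j; rewrite mxE; under eq_fun do rewrite mxE; exact: cvgD.
Qed.

Lemma mx_cvgN m n (A_ : nat -> 'M[R]_(m, n)) A :
  mx_cvg A_ A -> mx_cvg (fun k => - A_ k) (- A).
Proof.
move=> AA i j; rewrite mxE; under eq_fun do rewrite mxE; exact: cvgN.
Qed.

Lemma mx_cvgM m n p (A_ : nat -> 'M[R]_(m, n)) (B_ : nat -> 'M[R]_(n, p)) A B :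
  mx_cvg A_ A -> mx_cvg B_ B -> mx_cvg (fun k => A_ k *m B_ k) (A *m B).
Proof.
move=> AA BB i j; rewrite mxE; under eq_fun do rewrite mxE.
by apply: cvg_big => [|l _]; [exact: add_continuous|exact: cvgM].
Qed.

Lemma mx_cvg_cst m n (A : 'M[R]_(m, n)) : mx_cvg (fun=> A) A.
Proof. by move=> i j; exact: cvg_cst. Qed.

Lemma mx_cvg_eq0 m n (A_ : nat -> 'M[R]_(m, n)) A :
  (forall k, A_ k = 0) -> mx_cvg A_ A -> A = 0.
Proof.
move=> A0 AA; apply/matrixP => i j; rewrite mxE.
apply: (cvg_unique _ (AA i j)) => //.
rewrite (_ : (fun k => _) = fun=> 0); first exact: cvg_cst.
by apply/funext => k; rewrite A0 mxE.
Qed.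

Lemma cvg_trace_ip m n (A_ B_ : nat -> 'M[R]_(m, n)) A B :
  mx_cvg A_ A -> mx_cvg B_ B ->
  trace_ip (A_ k) (B_ k) @[k --> \oo] --> trace_ip A B.
Proof.
move=> AA BB; under eq_fun do rewrite trace_ipE; rewrite trace_ipE.
by do 2 (apply: cvg_big => [|? _]; first exact: add_continuous); exact: cvgM.
Qed.

End entrywise_convergence.

Section nuclear_norm_duality.
Context {R : realType}.

(** Spectral norm at most one; letting [Y] have any number of columns makes the
    inequality directly usable on matrices. *)
Definition contractive m n (W : 'M[R]_(m, n)) : Prop :=
  forall p (Y : 'M[R]_(n, p)), trace_ip (W *m Y) (W *m Y) <= trace_ip Y Y.

Lemma partial_isometry_contraction m n (W : 'M[R]_(m, n)) :
  W *m W^T *m W = W -> contractive W.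
Proof.
move=> WE p Y; rewrite -subr_ge0.
have -> : trace_ip Y Y - trace_ip (W *m Y) (W *m Y) =
    trace_ip (Y - W^T *m W *m Y) (Y - W^T *m W *m Y).
  rewrite trace_ip_sqrB -mulmxA (trace_ipC Y (W^T *m _)) !(trace_ip_mull W^T) trmxK.
  rewrite (mulmxA W W^T) (mulmxA _ W Y) WE; lra.
exact: trace_ip_ge0.
Qed.

Lemma contraction_tr m n (W : 'M[R]_(m, n)) : contractive W -> contractive W^T.
Proof.
move=> cW p Y; have := trace_ip_ge0 (Y - W *m (W^T *m Y)).
have := cW _ (W^T *m Y).
rewrite trace_ip_sqrB (trace_ipC Y (W *m _)) (trace_ip_mull W (W^T *m Y) Y); lra.
Qed.

(** In a rank factorization [E = L M] of an idempotent, [M L = 1]. *)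
Lemma mxrank_idempotent n (E : 'M[R]_n) : E *m E = E -> (\rank E)%:R = \tr E.
Proof.
move=> EE; rewrite -[in RHS](mulmx_base E) mxtrace_mulC.
suff -> : row_base E *m col_base E = 1%:M by rewrite mxtrace1.
apply: (row_free_inj (row_base_free E)); rewrite mul1mx.
apply: (row_full_inj (col_base_full E)).
by rewrite -mulmxA (mulmx_base E) mulmxA (mulmx_base E) EE.
Qed.

Variables m n : nat.
Implicit Types X Y W : 'M[R]_(m, n).

(** With [X = U S V^T], take [A = U S^(1/2)], [B = V S^(1/2)] and [W = U V^T].
    Splitting the singular values evenly makes the nuclear norm the square of the
    norm of either factor, so that duality reduces to the inequality between
    arithmetic and geometric means. The matrix [Q] is the inverse of [S] on its
    support. *)
Lemma polar_factorization X :
  exists (A : 'M[R]_m) (B : 'M[R]_(n, m)) (Q : 'M[R]_m) W,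
  [/\ X = A *m B^T,
      trace_ip A A = nuclear_norm X /\ trace_ip B B = nuclear_norm X,
      W *m B = A /\ W^T *m A = B, W = A *m Q *m B^T &
      trace_ip W W = (\rank X)%:R].
Proof.
have [U [V]] := svd X; set e := (\row_i _) => -[UU XE VV Ve].
pose s := sigma X; pose E := diag_mx e.
pose T := diag_mx (\row_i Num.sqrt (s 0 i)).
pose q : 'rV[R]_m := \row_i (s 0 i)^-1.
have s0 i : 0 <= s 0 i := sigma_ge0 X i.
have TT : T *m T = diag_mx s.
  by rewrite mulmx_diag; congr diag_mx; apply/rowP => i; rewrite !mxE -expr2 sqr_sqrtr.
have TE : T *m E = T.
  rewrite mulmx_diag; congr diag_mx; apply/rowP => i; rewrite !mxE.
  by have [->|_] := eqVneq (s 0 i) 0; rewrite ?sqrtr0 ?mul0r ?mulr1.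
have ET : E *m T = T by rewrite diag_mxC.
have Tt : T^T = T by rewrite tr_diag_mx.
have Et : E^T = E by rewrite tr_diag_mx.
have EE : E *m E = E.
  rewrite mulmx_diag; congr diag_mx; apply/rowP => i; rewrite !mxE.
  by case: (_ != _); rewrite ?mul0r ?mulr1.
have TqT : T *m diag_mx q *m T = E.
  rewrite !mulmx_diag; congr diag_mx; apply/rowP => i; rewrite !mxE mulrAC -expr2.
  by rewrite sqr_sqrtr//; have [->|?] := eqVneq (s 0 i) 0; rewrite ?mul0r ?divff.
have rkE : (\rank E = \rank X)%N.
  apply/eqP; rewrite eqn_leq; apply/andP; split.
    have -> : E = diag_mx q *m U^T *m X *m V.
      rewrite XE -!mulmxA (mulmxA U^T) UU mul1mx VV -/s -/E -TT -[T *m T *m E]mulmxA TE.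
      rewrite TT mulmx_diag; congr diag_mx; apply/rowP => i; rewrite !mxE.
      by have [->|?] := eqVneq (s 0 i) 0; rewrite ?mulr0 ?mulVf.
    apply: leq_trans (mxrankM_maxl _ _) _; exact: mxrankM_maxr.
  have -> : X = U *m E *m (diag_mx s *m V^T).
    by rewrite [LHS]XE -TT -!mulmxA [E *m _]mulmxA ET.
  apply: leq_trans (mxrankM_maxl _ _) _; exact: mxrankM_maxr.
have nT : trace_ip T T = nuclear_norm X.
  by rewrite /trace_ip Tt TT mxtrace_diag.
exists (U *m T), (V *m T), (diag_mx q), (U *m V^T); split.
- by rewrite [LHS]XE trmx_mul Tt -TT !mulmxA.
- by rewrite !trace_ip_mull (mulmxA U^T) (mulmxA V^T) UU VV mul1mx -/E ET.
- rewrite trmx_mul trmxK -!mulmxA (mulmxA V^T) (mulmxA U^T) UU VV mul1mx -/E ET.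
  by [].
- rewrite trmx_mul Tt -!mulmxA (mulmxA T) (mulmxA (T *m _)) TqT -{1}Ve -/E.
  by rewrite trmx_mul Et.
- rewrite -rkE mxrank_idempotent// trace_ip_mull (mulmxA U^T) UU mul1mx.
  by rewrite /trace_ip trmxK mxtrace_mulC VV.
Qed.

(** [<W, A B^T> = <W B, A>], and neither [W B] nor [A] has norm greater than the
    square root of the nuclear norm. *)
Lemma nuclear_norm_ge W Y : contractive W -> trace_ip W Y <= nuclear_norm Y.
Proof.
have [A [B [Q [W0 [-> [AA BB] _ _ _]]]]] := polar_factorization Y => cW.
rewrite trace_ip_mul_tr.
have := trace_ip_amgm (W *m B) A; have := cW _ B; lra.
Qed.

Lemma nuclear_norm_attained X :
  exists2 W, contractive W & nuclear_norm X = trace_ip W X.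
Proof.
have [A [B [Q [W [XE [AA BB] [WB WA] WQ _]]]]] := polar_factorization X.
exists W.
  apply: partial_isometry_contraction; rewrite [X in _ *m X = _]WQ !mulmxA.
  by rewrite -(mulmxA W) WA WB -WQ.
by rewrite {2}XE trace_ip_mul_tr WB AA.
Qed.

Lemma nuclear_normD X Y : nuclear_norm (X + Y) <= nuclear_norm X + nuclear_norm Y.
Proof.
have [W cW ->] := nuclear_norm_attained (X + Y).
by rewrite trace_ipDr lerD ?nuclear_norm_ge.
Qed.

Lemma nuclear_normZ k X : 0 <= k -> nuclear_norm (k *: X) <= k * nuclear_norm X.
Proof.
move=> k0; have [W cW ->] := nuclear_norm_attained (k *: X).
by rewrite trace_ipZr ler_wpM2l// nuclear_norm_ge.
Qed.

(** For [Y = W B B^T] and a contractive [W'] that attains the norm of [Y],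
    [|W B|^2 = <W, Y> <= <W', Y> = <W' B, W B> <= |B| |W B|]. *)
Lemma contraction_dual W :
  (forall Y, trace_ip W Y <= nuclear_norm Y) -> contractive W.
Proof.
move=> hW p B; have := hW (W *m B *m B^T).
have [W' cW' ->] := nuclear_norm_attained (W *m B *m B^T).
rewrite !trace_ip_mul_tr => h.
have := trace_ip_amgm (W' *m B) (W *m B); have := cW' _ B; lra.
Qed.

(** Equality case of [nuclear_norm_ge]: then [|W B - A|^2] and [|W^T A - B|^2]
    are nonpositive. *)
Lemma nuclear_norm_aligned p X W (A : 'M[R]_(m, p)) (B : 'M[R]_(n, p)) :
  X = A *m B^T ->
  trace_ip A A = nuclear_norm X -> trace_ip B B = nuclear_norm X ->
  contractive W -> trace_ip W X = nuclear_norm X ->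
  W *m B = A /\ W^T *m A = B.
Proof.
move=> XE AA BB cW WX.
have WBA : trace_ip (W *m B) A = nuclear_norm X.
  by rewrite -WX {1}XE trace_ip_mul_tr.
split; apply/subr0_eq/trace_ip_eq0; rewrite trace_ip_sqrB.
  by rewrite WBA AA; have := cW _ B; lra.
rewrite (trace_ip_mull W^T A B) trmxK (trace_ipC A) WBA BB.
have := contraction_tr cW A; lra.
Qed.

Definition nuclear_dual_pair X W : Prop :=
  contractive W /\ trace_ip W X = nuclear_norm X.

(** This form of the graph is convenient for building curves in it: a rotation
    acts on the equations, and [C] may be multiplied on the right by any matrix. *)
Lemma nuclear_dual_pairP X W : nuclear_dual_pair X W <->
  contractive W /\ exists C : 'M[R]_(n, m),
    X = W *m C *m C^T /\ W^T *m (W *m C) = C.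
Proof.
split=> -[cW].
  move=> WX; split=> //.
  have [A [B [Q [W0 [XE [AA BB] _ _ _]]]]] := polar_factorization X.
  have [WB WA] := nuclear_norm_aligned XE AA BB cW WX.
  by exists B; rewrite WB WA.
move=> [C [XE WC]]; split=> //; apply/eqP; rewrite eq_le nuclear_norm_ge//=.
have [W' cW' ->] := nuclear_norm_attained X.
rewrite XE !trace_ip_mul_tr (trace_ip_mull W C (W *m C)) WC.
have := trace_ip_amgm (W' *m C) (W *m C); have := cW' _ C; have := cW _ C; lra.
Qed.

(** Every [W] dual to [X] has the same inner product with the polar factor [W0],
    because [W0 = A Q B^T] and [W B = A]; hence [<W, W0> = <W0, W0>], and the
    latter is the rank of [X]. *)
Lemma rank_le_dual X W : nuclear_dual_pair X W -> (\rank X)%:R <= trace_ip W W.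
Proof.
move=> [cW WX].
have [A [B [Q [W0 [XE [AA BB] [W0B _] W0Q <-]]]]] := polar_factorization X.
have [WB _] := nuclear_norm_aligned XE AA BB cW WX.
have E W' : W' *m B = A -> trace_ip W' W0 = trace_ip A (A *m Q).
  by move=> W'B; rewrite W0Q trace_ip_mul_tr W'B.
have := trace_ip_amgm W W0; rewrite (E _ WB) -(E _ W0B); lra.
Qed.

Lemma nuclear_dual_exists X : exists W,
  [/\ W *m W^T *m W = W, nuclear_dual_pair X W & trace_ip W W = (\rank X)%:R].
Proof.
have [A [B [Q [W [XE [AA BB] [WB WA] WQ rW]]]]] := polar_factorization X.
have WW : W *m W^T *m W = W.
  by rewrite [X in _ *m X = _]WQ !mulmxA -(mulmxA W) WA WB -WQ.
exists W; split=> //; split; first exact: partial_isometry_contraction.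
by rewrite {1}XE trace_ip_mul_tr WB AA.
Qed.

(** A regular subgradient of a sublinear function is dual to its point: test it in
    the directions of an arbitrary [Y] and of the opposite of the point. Duality is
    a closed condition, so limits bring nothing new. *)
Lemma subdiff_nuclearP X W : subdiff_nuclear X W <-> nuclear_dual_pair X W.
Proof.
have euc := trace_ip_euclidean (R := R) m n.
split=> [[_ [z_ [w_ [zw zX NzX wW]]]]|[cW WX]]; last first.
  apply: regular_limiting_subdiff.
  apply: (regular_subdiff_quadratic euc (K := 0)) => //.
  near=> Y; rewrite mul0r subr0 -EFinD lee_fin -WX trace_ipBr addrC subrK.
  exact: nuclear_norm_ge.
have {}zX := cvg_mx_cvg zX; have {}wW := cvg_mx_cvg wW.
have line k d b : (forall t : R, 0 < t < 1 ->
    nuclear_norm (z_ k + t *: d) <= nuclear_norm (z_ k) + t * b) ->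
    trace_ip (w_ k) d <= b.
  move=> h; apply: (regular_subdiff_curve euc (zw k) (tau := 1) (C := 0)) => // t t01.
  exists (z_ k + t *: d); split; last by rewrite -EFinD lee_fin; exact: h.
  by rewrite addrAC addrK subrr (ipnorm0 euc) mul0r.
have wY k Y : trace_ip (w_ k) Y <= nuclear_norm Y.
  apply: line => t /andP[t0 _]; apply: (le_trans (nuclear_normD _ _)).
  by rewrite lerD2l; apply: nuclear_normZ; exact: ltW.
have wz k : nuclear_norm (z_ k) <= trace_ip (w_ k) (z_ k).
  suff : trace_ip (w_ k) (- z_ k) <= - nuclear_norm (z_ k).
    by rewrite -scaleN1r trace_ipZr mulN1r lerN2.
  apply: line => t /andP[t0 t1].
  have -> : z_ k + t *: - z_ k = (1 - t) *: z_ k by rewrite scalerN scalerBl scale1r.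
  by apply: le_trans (nuclear_normZ _ _) _; lra.
have cW : contractive W.
  apply: contraction_dual => Y.
  apply: (ler_cvg_to (cvg_trace_ip wW (@mx_cvg_cst _ _ _ Y))
    (cvg_cst (nuclear_norm Y))).
  by near=> k; exact: wY.
split=> //; apply/eqP; rewrite eq_le nuclear_norm_ge//=.
move/fine_cvg: NzX => /= NzX.
apply: (ler_cvg_to NzX (cvg_trace_ip wW zX)).
by near=> k; exact: wz.
Unshelve. all: by end_near. Qed.

End nuclear_norm_duality.

(** * The limiting subdifferential of the rank *)

Section rank_subdifferential.
Context {R : realType}.

Lemma sqr_trace_ip_le m n (A B : 'M[R]_(m, n)) :
  trace_ip A B ^+ 2 <= trace_ip A A * trace_ip B B.
Proof.
have euc := trace_ip_euclidean (R := R) m n.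
rewrite -!(ipnorm_sqr euc) -exprMn -[leLHS]ger0_norm ?sqr_ge0// normrX.
rewrite ler_pXn2r ?nnegrE ?mulr_ge0 ?ipnorm_ge0// ler_norml (ip_le_mul euc)//.
rewrite andbT lerNl -mulN1r -trace_ipZr; apply: le_trans (ip_le_mul euc _ _) _.
by rewrite (ipnormZ euc) normrN1 mul1r.
Qed.

(** Cauchy-Schwarz on each entry of the product. *)
Lemma trace_ip_mul_le m n p (A : 'M[R]_(m, n)) (B : 'M[R]_(n, p)) :
  trace_ip (A *m B) (A *m B) <= trace_ip A A * trace_ip B B.
Proof.
have rA i : trace_ip (row i A)^T (row i A)^T = \sum_k A i k ^+ 2.
  rewrite trace_ip_sqrE big_ord1; apply: eq_bigr => k _; rewrite !mxE//.
have cB j : trace_ip (col j B) (col j B) = \sum_k B k j ^+ 2.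
  rewrite trace_ip_sqrE big_ord1; apply: eq_bigr => k _; rewrite !mxE//.
have AB i j : (A *m B) i j = trace_ip (row i A)^T (col j B).
  by rewrite mxE trace_ipE big_ord1; apply: eq_bigr => k _; rewrite !mxE.
rewrite ![trace_ip _ _]trace_ip_sqrE [X in _ <= X * _]exchange_big /=.
rewrite mulr_sumr; apply: ler_sum => j _; rewrite mulr_suml; apply: ler_sum => i _.
by rewrite AB -rA -cB sqr_trace_ip_le.
Qed.

Variables m n : nat.
Implicit Types X Z H : 'M[R]_(m, n).

Lemma rank_witness X : exists (A : 'M[R]_(\rank X, m)) (B : 'M[R]_(n, \rank X)),
  A *m X *m B = 1%:M.
Proof.
exists (pid_mx (\rank X) *m invmx (col_ebase X)),
  (invmx (row_ebase X) *m pid_mx (\rank X)).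
have XE := mulmx_ebase X; rewrite -[X in _ *m X *m _ = _]XE !mulmxA.
rewrite mulmxKV ?col_ebase_unit//.
rewrite mulmxK ?row_ebase_unit// !mul_pid_mx.
rewrite -[RHS]pid_mx_1; congr pid_mx.
by rewrite !(minn_idPr _) ?minnn ?rank_leq_row ?rank_leq_col ?leq_min ?leqnn.
Qed.

(** The rows of [A Z] span the row space of [Z], so [Z = D A Z] for some [D], and
    multiplication by [B] on the right determines [D]. *)
Lemma fixed_rank_factorization r Z (A : 'M[R]_(r, m)) (B : 'M[R]_(n, r)) :
  A *m Z *m B \in unitmx -> \rank Z = r ->
  Z = Z *m B *m invmx (A *m Z *m B) *m (A *m Z).
Proof.
move=> uM rZ.
have rAZ : \rank (A *m Z) = r.
  apply/eqP; rewrite eqn_leq rank_leq_row/= -[leqLHS](mxrank_unit uM).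
  exact: mxrankM_maxl.
have /submxP[D ZE] : (Z <= A *m Z)%MS.
  by rewrite -(mxrank_leqif_sup (submxMl A Z)) rAZ rZ.
by rewrite {2}ZE -(mulmxA D) mulmxK.
Qed.

(** A quantitative invertibility of [1 + D]: it bounds the norm of its inverse by
    [2]. *)
Lemma near_identity_lower_bound r p (D : 'M[R]_r) (Y : 'M[R]_(r, p)) :
  trace_ip D D <= 4^-1 ->
  trace_ip Y Y <= 4 * trace_ip ((1%:M + D) *m Y) ((1%:M + D) *m Y).
Proof.
move=> D4; set M := (1%:M + D) *m Y.
have -> : trace_ip Y Y = trace_ip (M - D *m Y) (M - D *m Y).
  by rewrite /M mulmxDl mul1mx addrK.
have DY : trace_ip (D *m Y) (D *m Y) <= 4^-1 * trace_ip Y Y.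
  by apply: le_trans (trace_ip_mul_le _ _) _; rewrite ler_wpM2r// trace_ip_ge0.
have := trace_ip_ge0 (M + D *m Y).
have YE : Y = M - D *m Y by rewrite /M mulmxDl mul1mx addrK.
have : trace_ip Y Y = trace_ip (M - D *m Y) (M - D *m Y) by rewrite -YE.
rewrite trace_ip_sqrB trace_ipDl !trace_ipDr (trace_ipC (D *m Y) M); lra.
Qed.

(** Near [X], a minor of maximal rank remains invertible, so the rank cannot drop.
    If it does not jump either, then [Z = Z G Z] with [G] bounded; both outer
    factors [Z] may be replaced by [Z - X] in [<H, Z G Z>], by the hypotheses on
    [H], and what remains is quadratic in [Z - X]. *)
Lemma rank_expansion X H : X^T *m H = 0 -> H *m X^T = 0 ->
  exists2 K : R, 0 <= K & \forall Z \near X, (\rank X <= \rank Z)%N /\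
    ((\rank Z <= \rank X)%N ->
     trace_ip H (Z - X) <= K * trace_ip (Z - X) (Z - X)).
Proof.
move=> XH HX; have [A [B AXB]] := rank_witness X.
have euc := trace_ip_euclidean (R := R) m n.
pose a := trace_ip A A; pose b := trace_ip B B; pose h := trace_ip H H.
have a0 : 0 <= a := trace_ip_ge0 A.
have b0 : 0 <= b := trace_ip_ge0 B.
have h0 : 0 <= h := trace_ip_ge0 H.
exists ((h + 4 * a * b) / 2); first by rewrite divr_ge0// addr_ge0// !mulr_ge0.
pose d := (2 * (1 + a * b))^-1.
have d0 : 0 < d by rewrite invr_gt0 mulr_gt0// ltr_wpDr ?mulr_ge0.
apply: filterS (nbhs_ipnorm euc X d0) => Z Zd.
set Dx := Z - X in Zd *; pose q := trace_ip Dx Dx.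
have q0 : 0 <= q := trace_ip_ge0 Dx.
have qd : q <= d ^+ 2.
  by rewrite /q -(ipnorm_sqr euc) ler_pXn2r ?nnegrE ?ipnorm_ge0 ?(ltW d0)// ltW.
pose D := A *m Dx *m B.
have D4 : trace_ip D D <= 4^-1.
  apply: (@le_trans _ _ (a * q * b)).
    apply: le_trans (trace_ip_mul_le _ _) _.
    by rewrite ler_wpM2r// trace_ip_mul_le.
  have : d * (1 + a * b) = 2^-1.
    by rewrite /d invfM mulfVK// gt_eqF// ltr_wpDr ?mulr_ge0.
  have ab0 : 0 <= a * b by rewrite mulr_ge0.
  have : q * (a * b) <= d ^+ 2 * (a * b) by rewrite ler_wpM2r.
  nra.
have ME : A *m Z *m B = 1%:M + D.
  by rewrite /D /Dx mulmxBr mulmxBl AXB addrC subrK.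
set M := A *m Z *m B in ME.
have lowM p (Y : 'M[R]_(_, p)) : trace_ip Y Y <= 4 * trace_ip (M *m Y) (M *m Y).
  by rewrite ME; exact: near_identity_lower_bound.
have uM : M \in unitmx.
  rewrite -row_full_unit -cokermx_eq0; apply/eqP/trace_ip_eq0.
  by apply: le_trans (lowM _ _) _; rewrite mulmx_coker (ip0r (trace_ip_euclidean _ _)) mulr0.
have rXZ : (\rank X <= \rank Z)%N.
  rewrite -[leqLHS](mxrank_unit uM).
  by apply: leq_trans (mxrankM_maxl _ _) _; exact: mxrankM_maxr.
split=> // rZX.
have ZE : Z = Z *m B *m invmx M *m (A *m Z).
  by apply: fixed_rank_factorization => //; apply/eqP; rewrite eqn_leq rZX rXZ.
have HTZ : Z^T *m H = Dx^T *m H by rewrite /Dx linearB/= mulmxBl XH subr0.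
have HZT : H *m Z^T = H *m Dx^T by rewrite /Dx linearB/= mulmxBr HX subr0.
have HX0 : trace_ip H X = 0.
  by rewrite trace_ipC /trace_ip XH mxtrace0.
pose G := B *m invmx M *m A.
have ZGZ : Z = Z *m G *m Z by rewrite [LHS]ZE !mulmxA.
have -> : trace_ip H Dx = trace_ip (Dx^T *m H) (G *m Dx).
  transitivity (trace_ip H (Z *m G *m (Z^T)^T)).
    by rewrite trmxK -ZGZ [in LHS]/Dx trace_ipBr HX0 subr0.
  rewrite trace_ip_mul_tr HZT -trace_ip_mul_tr trmxK -mulmxA.
  by rewrite trace_ipC trace_ip_mull HTZ trace_ipC.
have := trace_ip_amgm (Dx^T *m H) (G *m Dx).
have : trace_ip (Dx^T *m H) (Dx^T *m H) <= q * h.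
  by apply: le_trans (trace_ip_mul_le _ _) _; rewrite trace_ip_tr.
have : trace_ip (G *m Dx) (G *m Dx) <= b * (4 * (a * q)).
  rewrite /G -!mulmxA; apply: le_trans (trace_ip_mul_le _ _) _; rewrite ler_wpM2l//.
  apply: le_trans (lowM _ _) _; rewrite mulKVmx// ler_wpM2l//.
  exact: trace_ip_mul_le.
rewrite -/q; lra.
Qed.

(** The rank does not increase along [X + t X N] and [X + t N X]. *)
Lemma regular_subdiff_rank_orthogonal X H :
  regular_subdiff trace_ip (fun Y : 'M[R]_(m, n) => (\rank Y)%:R%:E) X H ->
  X^T *m H = 0 /\ H *m X^T = 0.
Proof.
move=> XH; have euc := trace_ip_euclidean (R := R) m n.
have dir d : (forall t : R, (\rank (X + t *: d)%R <= \rank X)%N) -> trace_ip H d <= 0.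
  move=> rd; apply: (regular_subdiff_curve euc XH (tau := 1) (C := 0)) => // t _.
  exists (X + t *: d); rewrite addrAC addrK subrr (ipnorm0 euc) mul0r; split=> //.
  by rewrite mulr0 adde0 lee_fin ler_nat; exact: rd.
split; apply: trace_ip_eq0.
- rewrite trace_ip_mull trmxK; apply: dir => t.
  have -> : X + t *: (X *m (X^T *m H)) = X *m (1%:M + t *: (X^T *m H)).
    by rewrite mulmxDr mulmx1 -scalemxAr.
  exact: mxrankM_maxl.
- rewrite -trace_ip_mul_tr trmxK; apply: dir => t.
  have -> : X + t *: (H *m X^T *m X) = (1%:M + t *: (H *m X^T)) *m X.
    by rewrite mulmxDl mul1mx -scalemxAl.
  exact: mxrankM_maxr.
Qed.

Lemma subdiff_rankP X H :
  subdiff_rank X H <-> X^T *m H = 0 /\ H *m X^T = 0.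
Proof.
have euc := trace_ip_euclidean (R := R) m n.
split=> [[_ [z_ [h_ [zh zX _ hH]]]]|[XH HX]].
  have zX' := cvg_mx_cvg zX; have hH' := cvg_mx_cvg hH.
  split.
    apply: (mx_cvg_eq0 _ (mx_cvgM (mx_cvg_tr zX') hH')) => k.
    by case: (regular_subdiff_rank_orthogonal (zh k)).
  apply: (mx_cvg_eq0 _ (mx_cvgM hH' (mx_cvg_tr zX'))) => k.
  by case: (regular_subdiff_rank_orthogonal (zh k)).
have [K K0 XK] := rank_expansion XH HX.
apply: regular_limiting_subdiff; apply: (regular_subdiff_quadratic euc (K := K)) => //.
pose d := (1 + ipnorm trace_ip H)^-1.
have H0 : 0 < 1 + ipnorm trace_ip H by rewrite ltr_wpDr ?ipnorm_ge0.
have d0 : 0 < d by rewrite invr_gt0.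
apply: filterS2 XK (nbhs_ipnorm euc X d0) => Z [rXZ rZX] Zd.
rewrite -EFinD lee_fin (ipnorm_sqr euc).
have q0 := trace_ip_ge0 (Z - X).
have [rle|rgt] := leqP (\rank Z) (\rank X).
  have := rZX rle; have : (\rank X)%:R <= (\rank Z)%:R :> R by rewrite ler_nat.
  lra.
(* where the rank jumps, it jumps by at least one *)
have : (\rank X)%:R + 1 <= (\rank Z)%:R :> R by rewrite natr1 ler_nat.
have : trace_ip H (Z - X) <= 1.
  apply: le_trans (ip_le_mul euc _ _) _.
  apply: (@le_trans _ _ ((1 + ipnorm trace_ip H) * d)); last by rewrite divff ?gt_eqF.
  by apply: ler_pM; rewrite ?ipnorm_ge0 ?lerDr// ltW.
have := mulr_ge0 K0 q0; lra.
Qed.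

End rank_subdifferential.

(** * Orthogonal invariance and normals of the nuclear subdifferential graph *)

Section orthogonal_invariance.
Context {R : realType}.

Lemma sigma_mull m n (Q : 'M[R]_m) (X : 'M[R]_(m, n)) :
  Q^T *m Q = 1%:M -> sigma (Q *m X) = sigma X.
Proof.
move=> QQ; apply: singular_values_uniq (sigmaP _) _.
have [s0 s1 XE] := sigmaP X; split=> //.
have QQ' : Q *m Q^T = 1%:M by exact: mulmx1C.
have uQ : Q^T \in unitmx by case: (mulmx1_unit QQ).
have QV : invmx Q^T = Q by rewrite -[LHS]mulmx1 -QQ mulKmx.
by rewrite -XE trmx_mul mulmxA -{1}QV -(mulmxA _ X) char_poly_similar.
Qed.

Lemma sigma_mulr m n (Q : 'M[R]_n) (X : 'M[R]_(m, n)) :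
  Q *m Q^T = 1%:M -> sigma (X *m Q) = sigma X.
Proof.
move=> QQ; apply: singular_values_uniq (sigmaP _) _.
have [s0 s1 XE] := sigmaP X; split=> //.
by rewrite -XE trmx_mul mulmxA -(mulmxA X) QQ mulmx1.
Qed.

(** The Cayley transform [(1 + t K / 2) (1 - t K / 2)^-1] of a skew matrix is a
    rotation with velocity [K] at [t = 0]. It is preferred to the exponential
    because the error can be bounded by algebra alone. *)
Lemma cayley_curve k (K : 'M[R]_k) (t : R) : K^T = - K ->
  exists2 Q : 'M[R]_k, Q^T *m Q = 1%:M & forall p (M : 'M[R]_(k, p)),
    ipnorm trace_ip (Q *m M - M - t *: (K *m M)) <=
    ipnorm trace_ip (K *m (K *m M)) * t ^+ 2.
Proof.
move=> KT; pose L := (t / 2) *: K.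
have LT : L^T = - L by rewrite linearZ/= KT scalerN.
have low p (Y : 'M[R]_(k, p)) :
    trace_ip Y Y <= trace_ip ((1%:M - L) *m Y) ((1%:M - L) *m Y).
  rewrite mulmxBl mul1mx trace_ip_sqrB.
  have : trace_ip Y (L *m Y) = - trace_ip Y (L *m Y).
    by rewrite {1}trace_ipC trace_ip_mull LT mulNmx -scaleN1r trace_ipZr mulN1r.
  have := trace_ip_ge0 (L *m Y); lra.
have uL : 1%:M - L \in unitmx.
  rewrite -row_full_unit -cokermx_eq0; apply/eqP/trace_ip_eq0.
  by apply: le_trans (low _ _) _; rewrite mulmx_coker (ip0r (trace_ip_euclidean _ _)).
pose Q := (1%:M + L) *m invmx (1%:M - L).
have QQ : Q^T *m Q = 1%:M.
  have LL : (1%:M + L)^T *m (1%:M + L) = (1%:M - L)^T *m (1%:M - L).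
    rewrite !linearD linearN /= trmx1 LT opprK.
    rewrite !(mulmxDl, mulmxDr, mul1mx, mulmx1, mulmxN, mulNmx).
    by move: (L *m L) => L2; apply/matrixP => i j; rewrite !mxE; ring.
  rewrite /Q trmx_mul -mulmxA (mulmxA _^T (1%:M + L)) LL.
  by rewrite -(mulmxA _^T (1%:M - L)) mulmxV// mulmx1 -trmx_mul mulmxV// trmx1.
exists Q => // p M.
have QL : Q = 1%:M + L + Q *m L.
  have : Q *m (1%:M - L) = 1%:M + L by rewrite /Q mulmxKV.
  by rewrite mulmxBr mulmx1 => /(canRL (subrK _)).
(* [Q - 1 - 2 L = (1 + Q) L^2], where [1 + Q] at most doubles the norm *)
have -> : Q *m M - M - t *: (K *m M) = L *m (L *m M) + Q *m (L *m (L *m M)).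
  have -> : t *: (K *m M) = L *m M + L *m M.
    by rewrite -scalemxAl -scalerDl; congr (_ *: _); field.
  have QLM Y : Q *m Y = Y + L *m Y + Q *m (L *m Y).
    by rewrite {1}QL !mulmxDl mul1mx mulmxA.
  by rewrite (QLM p M) (QLM p (L *m M)); apply/matrixP => i j; rewrite !mxE; ring.
have euc := trace_ip_euclidean (R := R) k p.
apply: le_trans (ipnorm_triangle euc _ _) _.
have -> : ipnorm trace_ip (Q *m (L *m (L *m M))) = ipnorm trace_ip (L *m (L *m M)).
  by rewrite /ipnorm trace_ip_mull (mulmxA Q^T) QQ mul1mx.
have -> : L *m (L *m M) = (t / 2) ^+ 2 *: (K *m (K *m M)).
  by rewrite -!scalemxAl -scalemxAr scalerA expr2.
rewrite (ipnormZ euc) ger0_norm ?sqr_ge0//.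
have := ipnorm_ge0 trace_ip (K *m (K *m M)); have := sqr_ge0 t; nra.
Qed.

Lemma cayley_curve_right k (K : 'M[R]_k) (t : R) : K^T = - K ->
  exists2 Q : 'M[R]_k, Q *m Q^T = 1%:M & forall p (M : 'M[R]_(p, k)),
    ipnorm trace_ip (M *m Q - M - t *: (M *m K)) <=
    ipnorm trace_ip (M *m K *m K) * t ^+ 2.
Proof.
move=> KT; have [|Q QQ QM] := @cayley_curve _ K^T t.
  by rewrite trmxK KT opprK.
exists Q^T => [|p M]; first by rewrite trmxK.
have ipnorm_tr a b (A : 'M[R]_(a, b)) : ipnorm trace_ip A^T = ipnorm trace_ip A.
  by rewrite /ipnorm trace_ip_tr.
have := QM _ M^T; rewrite -ipnorm_tr -[X in _ <= X * _ -> _]ipnorm_tr.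
by rewrite !linearB linearZ/= !trmx_mul !trmxK.
Qed.

(** Symmetric matrices are the orthogonal complement of the skew ones. *)
Lemma symmetric_of_skew_test k (N : 'M[R]_k) :
  (forall K, K^T = - K -> trace_ip N K <= 0) -> N^T = N.
Proof.
move=> /(_ (N - N^T)); rewrite linearB/= trmxK opprB => /(_ erefl) h.
apply/esym/subr0_eq/trace_ip_eq0.
rewrite trace_ip_sqrB trace_ip_tr; move: h; rewrite trace_ipBr; lra.
Qed.

Variables m n : nat.
Implicit Types X W u v : 'M[R]_(m, n).

(** The singular values are constant along the rotations of [W], so [v] is
    orthogonal to all [K W] and [W K] with [K] skew. *)
Lemma regular_subdiff_sigma_symmetric (g : 'rV[R]_m -> \bar R) W v :
  regular_subdiff trace_ip (g \o sigma) W v ->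
  (v *m W^T)^T = v *m W^T /\ (W^T *m v)^T = W^T *m v.
Proof.
move=> gv; have [/= gW _] := gv.
have euc := trace_ip_euclidean (R := R) m n.
split; apply: symmetric_of_skew_test => K KT.
- rewrite -trace_ip_mul_tr trmxK.
  apply: (regular_subdiff_curve euc gv (tau := 1)) => // t _.
  have [Q QQ QW] := cayley_curve t KT.
  by exists (Q *m W); split; [exact: QW|rewrite /= sigma_mull// mulr0 adde0].
- rewrite trace_ip_mull trmxK.
  apply: (regular_subdiff_curve euc gv (tau := 1)) => // t _.
  have [Q QQ QW] := cayley_curve_right t KT.
  by exists (W *m Q); split; [exact: QW|rewrite /= sigma_mulr// mulr0 adde0].
Qed.

Lemma limiting_subdiff_sigma_symmetric (g : 'rV[R]_m -> \bar R) W v :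
  limiting_subdiff trace_ip (g \o sigma) W v ->
  (v *m W^T)^T = v *m W^T /\ (W^T *m v)^T = W^T *m v.
Proof.
move=> [_ [W_ [v_ [gv WW _ vv]]]].
have {}WW := mx_cvg_tr (cvg_mx_cvg WW); have {}vv := cvg_mx_cvg vv.
split; apply/subr0_eq.
- have h := mx_cvgM vv WW.
  apply: (mx_cvg_eq0 _ (mx_cvgD (mx_cvg_tr h) (mx_cvgN h))) => k.
  by have [-> _] := regular_subdiff_sigma_symmetric (gv k); rewrite subrr.
- have h := mx_cvgM WW vv.
  apply: (mx_cvg_eq0 _ (mx_cvgD (mx_cvg_tr h) (mx_cvgN h))) => k.
  by have [_ ->] := regular_subdiff_sigma_symmetric (gv k); rewrite subrr.
Qed.

End orthogonal_invariance.

Section nuclear_graph_normals.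
Context {R : realType} {m n : nat}.
Implicit Types X W u p : 'M[R]_(m, n).

Lemma ipnorm_prod_le X W : ipnorm (ip_prod trace_ip trace_ip) (X, W) <=
  ipnorm trace_ip X + ipnorm trace_ip W.
Proof.
have euc := trace_ip_euclidean (R := R) m n.
have pos := (ipnorm_ge0 trace_ip X, ipnorm_ge0 trace_ip W).
rewrite -(@ler_pXn2r _ 2) ?nnegrE ?addr_ge0 ?pos//; last exact: ipnorm_ge0.
rewrite (ipnorm_sqr (ip_prod_euclidean euc euc)) /ip_prod/= -!(ipnorm_sqr euc).
by rewrite sqrrD -addrA lerD2l lerDr mulrn_wge0// mulr_ge0 ?pos.
Qed.

Lemma nuclear_graph_rotl (Q : 'M[R]_m) X W : Q^T *m Q = 1%:M ->
  nuclear_dual_pair X W -> nuclear_dual_pair (Q *m X) (Q *m W).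
Proof.
move=> QQ /nuclear_dual_pairP[cW [C [XE WC]]]; apply/nuclear_dual_pairP; split.
  by move=> p Y; rewrite -mulmxA trace_ip_mull mulmxA QQ mul1mx; exact: cW.
exists C; rewrite {1}XE trmx_mul !mulmxA; split=> //.
by rewrite -(mulmxA W^T) QQ mulmx1 -mulmxA.
Qed.

Lemma nuclear_graph_rotr (Q : 'M[R]_n) X W : Q *m Q^T = 1%:M ->
  nuclear_dual_pair X W -> nuclear_dual_pair (X *m Q) (W *m Q).
Proof.
move=> QQ /nuclear_dual_pairP[cW [C [XE WC]]]; apply/nuclear_dual_pairP; split.
  move=> p Y; rewrite -mulmxA; apply: le_trans (cW _ _) _.
  by rewrite trace_ip_mull mulmxA mulmx1C// mul1mx.
exists (Q^T *m C); rewrite trmx_mul trmxK {1}XE !mulmxA; split.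
  by rewrite -(mulmxA W Q) QQ mulmx1.
by rewrite trmx_mul -!mulmxA (mulmxA Q) QQ mul1mx WC.
Qed.

(** The three conditions come from three families of curves in the graph: the
    rotations of [X] and [W] from the left, those from the right, and the
    deformations of [X] with [W] fixed. *)
Lemma nuclear_graph_normal_conditions X W u p :
  regular_normal (ip_prod trace_ip trace_ip) (gph (@subdiff_nuclear R m n))
    (X, W) (u, p) ->
  [/\ (u *m X^T + p *m W^T)^T = u *m X^T + p *m W^T,
      (X^T *m u + W^T *m p)^T = X^T *m u + W^T *m p &
      (X^T *m u *m W^T *m X)^T = - (X^T *m u *m W^T *m X)].
Proof.
move=> up; have euc := trace_ip_euclidean (R := R) m n.
have euc2 := ip_prod_euclidean euc euc.
have XW : nuclear_dual_pair X W by apply/subdiff_nuclearP; case: up.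
have curve dX dW C : (forall t : R, 0 < t < 1 -> exists X' W',
    [/\ nuclear_dual_pair X' W',
        ipnorm trace_ip (X' - X - t *: dX) <= C.1 * t ^+ 2 &
        ipnorm trace_ip (W' - W - t *: dW) <= C.2 * t ^+ 2]) ->
    trace_ip u dX + trace_ip p dW <= 0.
  move=> h; change (ip_prod trace_ip trace_ip (u, p) (dX, dW) <= 0).
  apply: (regular_normal_curve euc2 up (tau := 1) (C := C.1 + C.2)) => // t /h.
  move=> [X' [W' [XW' hX hW]]]; exists (X', W'); split; last exact/subdiff_nuclearP.
  by apply: le_trans (ipnorm_prod_le _ _) _; rewrite mulrDl lerD.
split.
- apply: symmetric_of_skew_test => K KT.
  rewrite trace_ipDl -!trace_ip_mul_tr !trmxK.
  apply: (curve _ _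
    (ipnorm trace_ip (K *m (K *m X)), ipnorm trace_ip (K *m (K *m W)))).
  move=> t _; have [Q QQ QM] := cayley_curve t KT.
  by exists (Q *m X), (Q *m W); split; [exact: nuclear_graph_rotl|exact: QM..].
- apply: symmetric_of_skew_test => K KT.
  rewrite trace_ipDl !trace_ip_mull !trmxK.
  apply: (curve _ _ (ipnorm trace_ip (X *m K *m K), ipnorm trace_ip (W *m K *m K))).
  move=> t _; have [Q QQ QM] := cayley_curve_right t KT.
  by exists (X *m Q), (W *m Q); split; [exact: nuclear_graph_rotr|exact: QM..].
- have /nuclear_dual_pairP[cW [C [XE WC]]] := XW.
  (* the curve obtained from [C (1 + t N)], with [N] the matrix to be tested *)
  have [N NE] : exists N, N = C^T *m W^T *m u *m C by eexists.
  have NT : N^T = - N.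
    apply/eqP; rewrite -addr_eq0; apply/eqP/trace_ip_eq0.
    have NN t : (1%:M + t *: N) *m (1%:M + t *: N)^T =
        1%:M + t *: (N + N^T) + t ^+ 2 *: (N *m N^T).
      rewrite linearD linearZ/= trmx1 mulmxDl mul1mx mulmxDr mulmx1.
      rewrite -scalemxAl -scalemxAr scalerA -expr2 scalerDr.
      by apply/matrixP => i j; rewrite !mxE; ring.
    have : trace_ip u (W *m C *m (N + N^T) *m C^T) + trace_ip p 0 <= 0.
      apply: (curve _ _ (ipnorm trace_ip (W *m C *m (N *m N^T) *m C^T), 0)) => t _.
      pose Ct := C *m (1%:M + t *: N).
      exists (W *m Ct *m Ct^T), W; split.
      + apply/nuclear_dual_pairP; split=> //; exists Ct; split=> //.
        by rewrite /Ct !mulmxA -(mulmxA W^T) WC.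
      + have -> : W *m Ct *m Ct^T =
            W *m C *m ((1%:M + t *: N) *m (1%:M + t *: N)^T) *m C^T.
          by rewrite /Ct trmx_mul !mulmxA.
        rewrite [Y in _ - Y - _]XE NN.
        rewrite (_ : _ - _ - _ = t ^+ 2 *: (W *m C *m (N *m N^T) *m C^T)).
          by rewrite (ipnormZ euc) ger0_norm ?sqr_ge0//= mulrC.
        rewrite 2!mulmxDr 2!mulmxDl mulmx1 -!scalemxAr -!scalemxAl.
        have cancel (a b c : 'M[R]_(m, n)) : a + b + c - a - b = c.
          by rewrite -addrA -opprD addrAC subrr add0r.
        exact: cancel.
      + by rewrite subrr add0r scaler0 oppr0 (ipnorm0 euc) mul0r.
    rewrite (ip0r euc) addr0.
    rewrite trace_ip_mul_tr trace_ipC trace_ip_mull trmx_mul mulmxA -NE.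
    rewrite !trace_ipDl !trace_ipDr trace_ip_tr (trace_ipC N^T N); lra.
  have WX : W^T *m X = C *m C^T by rewrite XE mulmxA WC.
  have -> : X^T *m u *m W^T *m X = C *m N *m C^T.
    by rewrite -(mulmxA _ W^T X) WX {1}XE !trmx_mul trmxK NE !mulmxA.
  by rewrite !trmx_mul trmxK NT mulNmx mulmxN mulmxA.
Qed.

(** With [B = X^T u] symmetric and [W^T X = C C^T], skewness reads
    [B C C^T + C C^T B = 0]. Taking the trace against [B] gives [C^T B = 0], then
    [B^2 = 0] as [B = C C^T W^T u], so [B = 0]. The square of the symmetric matrix
    [u X^T] contains the factor [B], so it vanishes as well. *)
Lemma orthogonality_of_symmetry X W u : nuclear_dual_pair X W ->
  (u *m X^T)^T = u *m X^T -> (X^T *m u)^T = X^T *m u ->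
  (X^T *m u *m W^T *m X)^T = - (X^T *m u *m W^T *m X) ->
  X^T *m u = 0 /\ u *m X^T = 0.
Proof.
move=> /nuclear_dual_pairP[cW [C [XE WC]]] uX Xu skew.
have WX : W^T *m X = C *m C^T by rewrite XE mulmxA WC.
pose B := X^T *m u.
have BT : B^T = B by exact: Xu.
have CB : C^T *m B = 0.
  apply: trace_ip_eq0; rewrite /trace_ip trmx_mul trmxK BT.
  have : B *m (C *m C^T) + C *m C^T *m B = 0.
    have := skew; rewrite -mulmxA WX -/B trmx_mul BT trmx_mul trmxK => ->.
    by rewrite subrr.
  move=> /(congr1 (mulmx B)); rewrite mulmxDr mulmx0 => /(congr1 mxtrace).
  rewrite mxtraceD mxtrace0 (mxtrace_mulC B (B *m _)) !mulmxA => h; lra.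
have BC : B *m C = 0 by rewrite -[LHS]trmxK trmx_mul BT CB trmx0.
have B0 : B = 0.
  apply: trace_ip_eq0; rewrite /trace_ip BT {2}/B XE !trmx_mul trmxK !mulmxA BC.
  by rewrite !mul0mx mxtrace0.
split=> //; apply: trace_ip_eq0.
by rewrite /trace_ip uX -mulmxA (mulmxA X^T) -/B B0 mul0mx mulmx0 mxtrace0.
Qed.

Lemma coderivative_nuclear_orthogonal X W v u :
  nuclear_dual_pair X W ->
  (v *m W^T)^T = v *m W^T -> (W^T *m v)^T = W^T *m v ->
  coderivative trace_ip trace_ip (@subdiff_nuclear R m n) X W v u ->
  X^T *m u = 0 /\ u *m X^T = 0.
Proof.
move=> XW vW Wv [_ [z_ [w_ [zw zX wu]]]].
have XX : mx_cvg (fun k => (z_ k).1) X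
  by exact: (cvg_mx_cvg (cvg_comp _ _ zX cvg_fst)).
have WW : mx_cvg (fun k => (z_ k).2) W
  by exact: (cvg_mx_cvg (cvg_comp _ _ zX cvg_snd)).
have uu : mx_cvg (fun k => (w_ k).1) u
  by exact: (cvg_mx_cvg (cvg_comp _ _ wu cvg_fst)).
have pp : mx_cvg (fun k => (w_ k).2) (- v)
  by exact: (cvg_mx_cvg (cvg_comp _ _ wu cvg_snd)).
have cond k := nuclear_graph_normal_conditions (zw k).
have lim0 a b (A_ : nat -> 'M[R]_(a, b)) A B_ B : mx_cvg A_ A -> mx_cvg B_ B ->
    (forall k, A_ k = B_ k) -> A = B.
  move=> AA BB AB; apply/subr0_eq/(mx_cvg_eq0 _ (mx_cvgD AA (mx_cvgN BB))) => k.
  by rewrite AB subrr.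
have h1 := mx_cvgD (mx_cvgM uu (mx_cvg_tr XX)) (mx_cvgM pp (mx_cvg_tr WW)).
have h2 := mx_cvgD (mx_cvgM (mx_cvg_tr XX) uu) (mx_cvgM (mx_cvg_tr WW) pp).
have h3 := mx_cvgM (mx_cvgM (mx_cvgM (mx_cvg_tr XX) uu) (mx_cvg_tr WW)) XX.
have {h1} uX : (u *m X^T - v *m W^T)^T = u *m X^T - v *m W^T.
  rewrite -!mulNmx; apply: (lim0 _ _ _ _ _ _ (mx_cvg_tr h1) h1) => k.
  by have [] := cond k.
have {h2} Xu : (X^T *m u - W^T *m v)^T = X^T *m u - W^T *m v.
  rewrite -!mulmxN; apply: (lim0 _ _ _ _ _ _ (mx_cvg_tr h2) h2) => k.
  by have [] := cond k.
have {h3} skew : (X^T *m u *m W^T *m X)^T = - (X^T *m u *m W^T *m X).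
  apply: (lim0 _ _ _ _ _ _ (mx_cvg_tr h3) (mx_cvgN h3)) => k.
  by have [] := cond k.
apply: (orthogonality_of_symmetry XW) => //.
- by move: uX; rewrite linearB/= vW => /(canRL (subrK _)); rewrite subrK.
- by move: Xu; rewrite linearB/= Wv => /(canRL (subrK _)); rewrite subrK.
Qed.

End nuclear_graph_normals.

(** * Surrogate functions and the subgradient at the polar factor *)

Section surrogate_functions.
Context {R : realType}.
Implicit Types phi : R -> \bar R.

Lemma family_L_fin_num phi s : family_L phi -> 0 <= s <= 1 -> phi s \is a fin_num.
Proof.
move=> L s01; rewrite fin_numE -ltNye -ltey (family_L_gtNy L)/=.
apply: (@interior_subset _ [set t | (phi t < +oo)%E]).
by apply: (family_L_int L); rewrite /= in_itv.
Qed.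

(** Otherwise [phi] is minimal on [[0, 1]] at some [t0 > 0], where it vanishes,
    while [phi 0 > 0]. By convexity [phi] decreases from any [s] near [0] with
    slope at least [(phi 0 / 2) / t0] in absolute value. A regular subgradient of
    [phi_hat] at [z] with [|z| = s], tested in the direction that moves [z] away
    from [0], is bounded below in absolute value by this slope, so that such
    subgradients do not tend to [0]. *)
Lemma phi_hat_critical_at_0 phi :
  family_L phi -> subdiff_phi_hat phi 0 0 -> phi 0 = 0%E.
Proof.
move=> L [_ [z_ [v_ [zv z0 phiz v0]]]].
have [t0 [argt0 t01 phit0]] := family_L_argmin L.
have : argmin_on `[0, 1] phi t0 by rewrite argt0.
rewrite /argmin_on /= in_itv/= => -[/andP[t0_ge0 _] t0min].
have /fineK phi0 : phi 0 \is a fin_num by rewrite (family_L_fin_num L)// lexx ler01.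
set a := fine (phi 0) in phi0.
have [t0E|t0n0] := eqVneq t0 0; first by move: phit0; rewrite t0E.
have t0p : 0 < t0 by rewrite lt_def t0n0.
have a0 : 0 < a.
  have a_ge0 : 0 <= a.
    by have := t0min 0; rewrite phit0 -phi0 lee_fin in_itv/= lexx ler01; apply.
  rewrite lt_def a_ge0 andbT; apply: contra_neq t0n0 => a0.
  apply/esym; have : argmin_on `[0, 1] phi 0; last by rewrite argt0.
  split=> [|s s01]; first by rewrite /= in_itv/= lexx ler01.
  by have := t0min s s01; rewrite phit0 -phi0 a0.
exfalso.
near \oo => k.
have s_lt : `|z_ k| < t0 by near: k; apply: cvgr0_norm_lt.
have v_lt : `|v_ k| < a / 2 / t0.
  by near: k; apply: cvgr0_norm_lt; rewrite ?divr_gt0.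
have ar : a / 2 < fine (phi `|z_ k|).
  near: k; apply: (@cvgr_gt _ _ _ _ _ a); last by lra.
  by move: phiz; rewrite {2}/phi_hat normr0 -phi0 => /fine_cvg.
move: s_lt v_lt ar; set s := `|z_ k|; set v := v_ k => s_lt v_lt.
have /fineK sE : phi s \is a fin_num.
  by rewrite (family_L_fin_num L)// normr_ge0/= ltW// (lt_trans s_lt).
set r := fine (phi s) in sE * => ar.
pose d : R := if 0 <= z_ k then 1 else -1.
have s0 : 0 <= s := normr_ge0 _.
have : v * d <= - (r / (t0 - s)).
  apply: (regular_subdiff_curve mulr_euclidean (zv k) (tau := t0 - s) (C := 0)).
    by rewrite subr_gt0.
  move=> t /andP[tp tlt]; exists (z_ k + t *: d); split.
    by rewrite addrAC addrK subrr (ipnorm0 mulr_euclidean) mul0r.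
  have -> : phi_hat phi (z_ k + t *: d) = phi (s + t).
    rewrite /phi_hat /d /s; congr phi; case: ifPn => zk.
      by rewrite scaler1 !ger0_norm// addr_ge0// ltW.
    rewrite -ltNge in zk; rewrite scalerN scaler1 !ler0_norm ?ltW//; last by lra.
    by rewrite opprB addrC.
  rewrite {1}/phi_hat -/s -sE.
  (* [s + t] is the point of the segment from [s] to [t0] with weight [l] on [t0] *)
  pose l := t / (t0 - s).
  have ts0 : 0 < t0 - s by rewrite subr_gt0.
  have l01 : 0 < l < 1 by rewrite divr_gt0//= ltr_pdivrMr// mul1r.
  have -> : s + t = l * t0 + (1 - l) * s.
    by rewrite /l; field; rewrite gt_eqF.
  apply: le_trans (family_L_convex L _ _ l01) _.
  rewrite phit0 mule0 add0e -sE -EFinM -EFinD lee_fin /l.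
  by rewrite le_eqVlt; apply/orP; left; apply/eqP; field; rewrite gt_eqF.
have rb : a / 2 / t0 <= r / (t0 - s).
  apply: ler_pM; [by rewrite ltW// divr_gt0|by rewrite invr_ge0 ltW|exact: ltW|].
  by rewrite lef_pV2 ?posrE ?subr_gt0//; lra.
move=> vd; have : `|v * d| = `|v|.
  by rewrite normrM /d; case: ifP; rewrite ?normrN normr1 mulr1.
have := ler_norm (- (v * d)); rewrite normrN => h1 h2; rewrite h2 in h1; clear -v_lt rb vd h1; lra.
Unshelve. all: by end_near. Qed.

(** The constant [c] is the left derivative of [phi] at [1], obtained as a supremum
    of slopes; it is at least the slope between [0] and [1], which is [1]. *)
Lemma supporting_line_at_1 phi : family_L phi -> phi 0 = 0%E ->
  exists2 c : R, 1 <= c & forall s, 0 <= s -> ((1 + c * (s - 1))%:E <= phi s)%E.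
Proof.
move=> L phi0.
pose slope s := (1 - fine (phi s)) / (1 - s).
pose E := [set slope s | s in `[0, 1[].
have slopes s u r : 0 <= s < 1 -> 1 < u -> phi u = r%:E ->
    slope s <= (r - 1) / (u - 1).
  move=> /andP[s0 s1] u1 phiu.
  have /fineK sE : phi s \is a fin_num by rewrite (family_L_fin_num L)// s0 ltW.
  rewrite /slope; set q := fine _ in sE *.
  pose l := (u - 1) / (u - s).
  have l01 : 0 < l < 1.
    by rewrite divr_gt0/= ?ltr_pdivrMr ?mul1r ?subr_gt0//; lra.
  have := family_L_convex L s u l01.
  have -> : l * s + (1 - l) * u = 1 by rewrite /l; field; rewrite gt_eqF//; lra.
  rewrite (family_L_1 L) phiu -sE -!EFinM -EFinD lee_fin.
  rewrite /l => h; have us : 0 < u - s by lra.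
  have : (u - s) * 1 <= (u - s) * ((u - 1) / (u - s) * q + (1 - (u - 1) / (u - s)) * r).
    by rewrite ler_pM2l.
  have -> : (u - s) * ((u - 1) / (u - s) * q + (1 - (u - 1) / (u - s)) * r) =
     (u - 1) * q + (1 - s) * r by field; rewrite gt_eqF.
  rewrite ler_pdivrMr ?subr_gt0// mulrAC ler_pdivlMr ?subr_gt0//; lra.
have [u u1 phiu] : exists2 u, 1 < u & phi u \is a fin_num.
  have := family_L_int L; move/(_ 1); rewrite /= in_itv/= ler01 lexx => /(_ isT).
  rewrite /interior /= -nbhs_nbhs_norm => -[e /= e0 he].
  exists (1 + e / 2); first by lra.
  rewrite fin_numE -ltNye -ltey (family_L_gtNy L)/=; apply: he => /=.
  by rewrite opprD addrA subrr add0r normrN gtr0_norm; lra.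
have slope0 : E 1.
  by exists 0; rewrite /= ?in_itv/= ?lexx ?ltr01// /slope phi0/= !subr0 divr1.
have Eub : has_sup E.
  split; first by exists 1.
  exists ((fine (phi u) - 1) / (u - 1)) => _ [s /= s01 <-].
  by apply: slopes; rewrite ?fineK.
exists (sup E); first exact: ub_le_sup (proj2 Eub) _ slope0.
move=> s s0; have [s1|s1|->] := ltgtP s 1.
- have /fineK sE : phi s \is a fin_num by rewrite (family_L_fin_num L)// s0 ltW.
  have : slope s <= sup E.
    by apply: ub_le_sup (proj2 Eub) _ _; exists s; rewrite //= in_itv/= s0.
  by rewrite /slope ler_pdivrMr ?subr_gt0// -sE lee_fin; lra.
- case phis: (phi s) => [r| |]; rewrite ?leey//; last first.
    by have := family_L_gtNy L s; rewrite phis.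
  have : sup E <= (r - 1) / (s - 1).
    apply: ge_sup; first by exists 1.
    by move=> _ [w /= w01 <-]; apply: slopes => //; rewrite in_itv in w01.
  by rewrite ler_pdivlMr ?subr_gt0// lee_fin; lra.
- by rewrite subrr mulr0 addr0 (family_L_1 L).
Qed.

Lemma family_L_ge0 phi s : family_L phi -> phi 0 = 0%E -> 0 <= s -> (0 <= phi s)%E.
Proof.
move=> L phi0 s0; have [c c1 line] := supporting_line_at_1 L phi0.
have [s1|s1] := leP s 1; last first.
  by apply: le_trans (line s s0); rewrite lee_fin; nra.
have [t0 [argt0 _ phit0]] := family_L_argmin L.
have : argmin_on `[0, 1] phi t0 by rewrite argt0.
by move=> [_ /(_ s)]; rewrite phit0 /= in_itv/= s0 s1; exact.
Qed.

End surrogate_functions.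

Section critical_points_of_surrogate.
Context {R : realType} {m n : nat}.
Implicit Types X W H : 'M[R]_(m, n).

(** The cubes of the singular values of a partial isometry are its singular
    values. *)
Lemma sigma_partial_isometry W : W *m W^T *m W = W ->
  (forall i, sigma W 0 i = 0 \/ sigma W 0 i = 1) /\
  trace_ip W W = \sum_i sigma W 0 i.
Proof.
move=> WW; have [U [V]] := svd W; set e := (\row_i _) => -[UU WE VV Ve].
set s := sigma W in WE e VV Ve *.
have se : diag_mx s *m diag_mx e = diag_mx s.
  rewrite mulmx_diag; congr diag_mx; apply/rowP => i; rewrite !mxE.
  by have [->|_] := eqVneq (s 0 i) 0; rewrite ?mul0r ?mulr1.
have WT : W^T = V *m diag_mx s *m U^T by rewrite {1}WE !trmx_mul trmxK tr_diag_mx mulmxA.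
have UWV : U^T *m W *m V = diag_mx s.
  by rewrite {1}WE !mulmxA UU mul1mx -mulmxA VV.
have s01 i : s 0 i = 0 \/ s 0 i = 1.
  have : diag_mx s *m diag_mx s *m diag_mx s = diag_mx s.
    rewrite -[in RHS]UWV -{1}WW WT {1 2}WE -!mulmxA VV se.
    rewrite (mulmxA U^T U) UU mul1mx (mulmxA U^T U) UU mul1mx.
    by rewrite (mulmxA V^T V) VV (mulmxA (diag_mx e)) [diag_mx e *m diag_mx s]diag_mxC se.
  rewrite !mulmx_diag => /matrixP/(_ i i); rewrite !mxE eqxx !mulr1n => h.
  have [->|s0] := eqVneq (s 0 i) 0; [by left|right].
  have h1 : s 0 i * s 0 i = 1 by apply: (mulIf s0); rewrite mul1r.
  have := sigma_ge0 W i; rewrite -/s; nra.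
split=> //.
rewrite /trace_ip WT {1}WE -!mulmxA (mulmxA U^T U) UU mul1mx mxtrace_mulC.
rewrite -!mulmxA VV se mulmx_diag mxtrace_diag; apply: eq_bigr => i _.
by rewrite mxE; case: (s01 i) => ->; rewrite ?mulr0 ?mulr1.
Qed.

(** Let [Y = U S V^T] and let [a i] be the diagonal entries of [U^T W V], so that
    [<W, Y>] is the sum of the [a i * s i]. There are weights [b i >= a i] in
    [[0, 1]] whose sum is at most [<W, W>], namely half of the squared norms of the
    columns of [W^T U] and [W V]. Interpolating between the bounds [0] and
    [1 + c (s - 1)] with weight [b i] gives
    [sum (phi (s i)) >= (1 - c) sum b + c sum (b s) >= <W, W> + c <W, Y - W>],
    where the last step uses [c >= 1]. *)
Lemma surrogate_subgradient phi W (c : R) : W *m W^T *m W = W ->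
  family_L phi -> phi 0 = 0%E -> 1 <= c ->
  (forall s, 0 <= s -> ((1 + c * (s - 1))%:E <= phi s)%E) ->
  regular_subdiff trace_ip (Phi_hat phi \o sigma) W (c *: W).
Proof.
move=> WW L phi0 c1 line; have euc := trace_ip_euclidean (R := R) m n.
have [s01 rE] := sigma_partial_isometry WW.
have gW : (Phi_hat phi \o sigma) W = (trace_ip W W)%:E.
  rewrite /= /Phi_hat rE -sumEFin; apply: eq_bigr => i _; rewrite /phi_hat.
  by case: (s01 i) => ->; rewrite ?normr0 ?normr1 ?(family_L_1 L) ?phi0.
apply: (regular_subdiff_quadratic euc (K := 0)); first by rewrite gW.
near=> Y; rewrite mul0r subr0 gW -EFinD /= trace_ipZl trace_ipBr.
have cW := partial_isometry_contraction WW.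
have cWt := contraction_tr cW.
have [U [V]] := svd Y; set e := (\row_i _) => -[UU YE VV Ve].
have sY0 i := sigma_ge0 Y i; set s := sigma Y in YE e VV Ve sY0 *.
pose P := W^T *m U; pose Z := W *m V.
pose alpha i := trace_ip (col i P) (col i P).
pose beta i := trace_ip (col i Z) (col i Z).
(* [a i = <W^T u_i, W^T W v_i>] is at most the mean [b i] of the two squares *)
pose b i := (alpha i + beta i) / 2.
have sumcol k (M : 'M[R]_(k, m)) : \sum_i trace_ip (col i M) (col i M) = trace_ip M M.
  rewrite [RHS]trace_ip_sqrE; apply: eq_bigr => i _.
  by rewrite trace_ip_sqrE big_ord1; apply: eq_bigr => l _; rewrite mxE.
have sumb : \sum_i b i <= trace_ip W W.
  have a1 : \sum_i alpha i = trace_ip W W.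
    by rewrite sumcol /P trace_ip_mulr trace_ipC -mulmxA mulmx1C// mulmx1 trace_ip_tr.
  have b1 : \sum_i beta i <= trace_ip W W.
    rewrite sumcol /Z -trace_ip_tr trmx_mul -(trace_ip_tr W W).
    apply: partial_isometry_contraction.
    by rewrite trmxK VV -[RHS](congr1 trmx Ve) trmx_mul tr_diag_mx.
  by rewrite /b -mulr_suml big_split/= a1; lra.
have alpha0 i : 0 <= alpha i := trace_ip_ge0 _.
have beta0 i : 0 <= beta i := trace_ip_ge0 _.
have colM k l (A : 'M[R]_(k, l)) (B : 'M[R]_(l, m)) i : col i (A *m B) = A *m col i B.
  by rewrite !colE mulmxA.
have col_ip k (A B : 'M[R]_(k, m)) i : trace_ip (col i A) (col i B) = (A^T *m B) i i.
  by rewrite trace_ipE big_ord1 mxE; apply: eq_bigr => l _; rewrite !mxE.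
have alpha1 i : alpha i <= 1.
  rewrite /alpha /P colM; apply: le_trans (cWt _ _) _.
  by rewrite col_ip UU mxE eqxx.
have beta1 i : beta i <= 1.
  rewrite /beta /Z colM; apply: le_trans (cW _ _) _.
  by rewrite col_ip VV !mxE eqxx mulr1n lern1 leq_b1.
have ab i : (U^T *m W *m V) i i <= b i.
  have -> : U^T *m W *m V = P^T *m (W^T *m Z).
    by rewrite /P /Z trmx_mul trmxK -{1}WW !mulmxA.
  rewrite -col_ip (colM _ _ W^T Z); have := trace_ip_amgm (col i P) (W^T *m col i Z).
  by have := cWt _ (col i Z); rewrite /b /alpha /beta; lra.
have WY : trace_ip W Y = \sum_i (U^T *m W *m V) i i * s 0 i.
  rewrite YE trace_ip_mul_tr trace_ipC trace_ip_mull mulmxA.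
  rewrite /trace_ip tr_diag_mx mul_diag_mx /mxtrace.
  by apply: eq_bigr => i _; rewrite mxE mulrC.
have point i : ((b i * (1 + c * (s 0 i - 1)))%:E <= phi_hat phi (s 0%R i))%E.
  rewrite /phi_hat ger0_norm//.
  have b0 : 0 <= b i by rewrite divr_ge0// addr_ge0.
  have b1 : b i <= 1 by rewrite /b; have := alpha1 i; have := beta1 i; lra.
  have [h|h] := leP 0 (1 + c * (s 0 i - 1)).
    by apply: le_trans (line _ (sY0 i)); rewrite lee_fin ler_piMl.
  by apply: le_trans (family_L_ge0 L phi0 (sY0 i)); rewrite lee_fin mulr_ge0_le0// ltW.
apply: (@le_trans _ _ (\sum_i (b i * (1 + c * (s 0 i - 1)))%:E)%E); last first.
  by rewrite /Phi_hat; apply: lee_sum => i _; exact: point.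
rewrite sumEFin lee_fin.
have bs : trace_ip W Y <= \sum_i b i * s 0 i.
  by rewrite WY; apply: ler_sum => i _; rewrite ler_wpM2r.
have -> : \sum_i b i * (1 + c * (s 0 i - 1)) =
    (1 - c) * \sum_i b i + c * \sum_i b i * s 0 i.
  by rewrite !mulr_sumr -big_split/=; apply: eq_bigr => i _; ring.
nra.
Unshelve. all: by end_near. Qed.

(** On the graph, [<W', W'>] is at least the rank of [X']. Being close to
    [<W, W> = rank X], it prevents the rank of [X'] from exceeding that of [X], so
    [rank_expansion] applies to [H]. Moreover [<W', W'> >= <W, W>], which means
    [- <W, W' - W> <= |W' - W|^2 / 2]. *)
Lemma nuclear_coderivative_of_rank_normal X W H (c : R) : 0 <= c ->
  nuclear_dual_pair X W -> trace_ip W W = (\rank X)%:R ->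
  X^T *m H = 0 -> H *m X^T = 0 ->
  coderivative trace_ip trace_ip (@subdiff_nuclear R m n) X W (c *: W) H.
Proof.
move=> c0 XW rW XH HX; have euc := trace_ip_euclidean (R := R) m n.
have euc2 := ip_prod_euclidean euc euc.
have [K K0 XK] := rank_expansion XH HX.
apply: regular_limiting_normal.
apply: (regular_normal_quadratic euc2 (K := K + c / 2)); first exact/subdiff_nuclearP.
(* for [|W' - W| < d] the squared norms of [W] and [W'] differ by less than 1 *)
pose d := (2 * ipnorm trace_ip W + 2)^-1.
have nW := ipnorm_ge0 trace_ip W.
have d0 : 0 < d by rewrite invr_gt0; lra.
have dE : d * (2 * ipnorm trace_ip W + 2) = 1 by rewrite mulVf// gt_eqF//; lra.
have XK2 : \forall z \near ((X, W) : 'M[R]_(m, n) * 'M[R]_(m, n)),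
    (\rank X <= \rank z.1)%N /\ ((\rank z.1 <= \rank X)%N ->
      trace_ip H (z.1 - X) <= K * trace_ip (z.1 - X) (z.1 - X)).
  exact: (@cvg_fst _ _ (nbhs X) (nbhs W) _ _ XK).
have Wd : \forall z \near ((X, W) : 'M[R]_(m, n) * 'M[R]_(m, n)),
    ipnorm trace_ip (z.2 - W) < d.
  exact: (@cvg_snd _ _ (nbhs X) (nbhs W) _ _ (nbhs_ipnorm euc W d0)).
apply: filterS2 XK2 Wd => -[X' W'] /= [rXX' rX'X] W'd.
move=> /subdiff_nuclearP XW'.
have rX' := rank_le_dual XW'.
set D := W' - W in W'd *.
have W'E : trace_ip W' W' = trace_ip W W + 2 * trace_ip W D + trace_ip D D.
  have -> : W' = W + D by rewrite /D addrC subrK.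
  by rewrite trace_ipDl (trace_ipDr W W D) (trace_ipDr D W D) (trace_ipC D W); ring.
have rX'X' : (\rank X' <= \rank X)%N.
  rewrite -ltnS -(ltr_nat R) -natr1; apply: le_lt_trans rX' _.
  rewrite W'E rW -!addrA ltrD2l.
  have := ip_le_mul euc W D; rewrite -(ipnorm_sqr euc D).
  move: (ipnorm_ge0 trace_ip D) W'd nW d0 dE.
  move: (ipnorm _ D) (ipnorm _ W) (trace_ip W D) => q w p q0 qd w0 d0 dE pwq.
  have d1 : d <= 1 by nra.
  have qw : q * (2 * w + 2) < d * (2 * w + 2) by rewrite ltr_pM2r//; lra.
  have : q ^+ 2 <= q by rewrite expr2 ler_piMl//; lra.
  lra.
have := rX'X rX'X'.
have : (\rank X)%:R <= (\rank X')%:R :> R by rewrite ler_nat.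
rewrite (ipnorm_sqr euc2) /ip_prod /= -/D -scaleNr trace_ipZl => h1 h2.
have := trace_ip_ge0 D; have := trace_ip_ge0 (X' - X); nra.
Qed.

End critical_points_of_surrogate.

(** * Equivalence of the stationarity notions *)

Theorem theorem3p1 (R : realType) (m n : nat) (nu : R)
    (Omega : set 'M[R]_(m, n)) (f : 'M[R]_(m, n) -> R)
    (le_mn : (m <= n)%N) (nu_gt0 : 0 < nu)
    (closed_Omega : closed Omega) (convex_Omega : convex_set Omega)
    (lipschitz_f : locally_lipschitz trace_ip f)
    (regular_f : forall X, Omega X ->
       regular_subdiff trace_ip (EFin \o f) X = subdiff_real f X) :
  (forall Xbar : 'M[R]_(m, n),
     (exists2 phi : R -> \bar R,
        family_L1 phi & M_stationary nu f Omega phi Xbar) ->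
     R_stationary nu f Omega Xbar)
  /\
  (forall Xbar : 'M[R]_(m, n),
     R_stationary nu f Omega Xbar ->
     forall phi : R -> \bar R,
       family_L phi -> subdiff_phi_hat phi 0 0 ->
       M_stationary nu f Omega phi Xbar).
Proof.
split=> X.
- move=> [phi _ [W [DW [/subdiff_nuclearP XW WDW [G [N [D [fG OmN XD eq0]]]]]]]].
  have [DWW WDW'] := limiting_subdiff_sigma_symmetric WDW.
  have [XD0 DX0] := coderivative_nuclear_orthogonal XW DWW WDW' XD.
  exists G, D, N; split=> //; first exact/subdiff_rankP.
  by rewrite addrAC.
- move=> [G [H [N [fG /subdiff_rankP[XH HX] OmN eq0]]]] phi L crit0.
  have phi0 := phi_hat_critical_at_0 L crit0.
  have [c c1 line] := supporting_line_at_1 L phi0.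
  have [W [WW XW rW]] := nuclear_dual_exists X.
  exists W, (c *: W); split; first exact/subdiff_nuclearP.
    apply: regular_limiting_subdiff; exact: surrogate_subgradient.
  exists G, N, H; split=> //; last by rewrite addrAC.
  by apply: nuclear_coderivative_of_rank_normal => //; exact: le_trans ler01 c1.
Qed.
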